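(* Let $\mathbb F$ be an algebraically closed field of characteristic different from $2$. For each positive integer $n$, let $N_n$ be any fixed $n\times n$ tridiagonal symmetric matrix over $\mathbb F$ that is similar to $J_n(0)$. (a) Every pair $(A,B)$ of symmetric matrices over $\mathbb F$ of the same size is congruent to a direct sum, determined uniquely up to permutation of summands, of tridiagonal pairs of the following three types: (i) $(I_n,\lambda I_n+N_n)$ with $n\geq 1$ and $\lambda\in\mathbb F$; (ii) $(N_n,I_n)$ with $n\ge1$; (iii) the pair of $(2k+1)\times(2k+1)$ symmetric tridiagonal matrices ($k\ge0$ an integer) with zero diagonals, in which the first matrix has entries in positions $(j,j+1)$ and $(j+1,j)$, $j=1,\dots,2k$, given by the sequence $1,0,1,0,\dots$, and the second matrix has entries in positions $(j,j+1)$ and $(j+1,j)$ given by the sequence $0,1,0,1,\dots$. (b) This direct sum is determined uniquely up to permutation of summands by the Kronecker canonical form of $(A,B)$ for equivalence. The Kronecker canonical form of each of the direct summands is as follows: of $(I_n,\lambda I_n+N_n)$ it is $(I_n,J_n(\lambda))$; of $(N_n,I_n)$ it is $(J_n(0),I_n)$; of the pair (iii) it is $(F_k,G_k)\oplus(F_k^T,G_k^T)$.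
   Context: Matrix pairs $(A,B)$ and $(A',B')$ of square matrices are congruent if there is a nonsingular $S$ with $S^TAS=A'$ and $S^TBS=B'$. Matrix pairs $(A,B)$ and $(A',B')$ are equivalent if there are nonsingular $R,S$ with $RAS=A'$ and $RBS=B'$. Direct sums of pairs are taken componentwise: $(A,B)\oplus(A',B')=(A\oplus A',B\oplus B')$. $I_n$ is the $n\times n$ identity matrix and $J_n(\lambda)$ is the $n\times n$ upper triangular Jordan block with eigenvalue $\lambda$ (ones on the superdiagonal). Matrices $N_n$ as in the claim are known to exist for every $n$ over $\mathbb F$. For $n\ge 0$, $F_n$ and $G_n$ are the $n\times(n+1)$ matrices $F_n=[\,I_n\ |\ 0\,]$ (identity followed by a zero column) and $G_n=[\,0\ |\ I_n\,]$ (zero column followed by the identity); $F_0=G_0$ is the $0\times 1$ matrix (taking a direct sum with it adjoins a zero column; with its transpose, a zero row). Kronecker's theorem: each pair of matrices of the same size is equivalent to a direct sum, determined uniquely up to permutation of summands, of pairs of the form $(I_n,J_n(\lambda))$, $(J_n(0),I_n)$, $(F_n,G_n)$, $(F_n^T,G_n^T)$; this direct sum is the Kronecker canonical form of the pair. *)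

(* Defs.v *)
From HB Require Import structures.
From mathcomp Require Import all_boot all_order all_algebra.

Set Implicit Arguments.
Unset Strict Implicit.
Unset Printing Implicit Defensive.

Import GRing.Theory.
Local Open Scope ring_scope.

Definition tridiagonal (F : fieldType) n (A : 'M[F]_n) : Prop :=
  forall i j : 'I_n, (i.+1 < j)%N || (j.+1 < i)%N -> A i j = 0.

Definition jordan_block (F : fieldType) n (lam : F) : 'M[F]_n :=
  \matrix_(i, j) (if i == j then lam else (j == i.+1 :> nat)%:R).

Definition mxpair (F : fieldType) (m n : nat) : Type :=
  ('M[F]_(m, n) * 'M[F]_(m, n))%type.

Definition dsum2 (F : fieldType) m n m' n'
    (P : mxpair F m n) (Q : mxpair F m' n') : mxpair F (m + m') (n + n') :=
  (block_mx P.1 0 0 Q.1, block_mx P.2 0 0 Q.2).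

(* The empty direct sum is the pair of 0 x 0 matrices. *)
Fixpoint dsum (F : fieldType) (T : Type) (r c : T -> nat)
    (P : forall x : T, mxpair F (r x) (c x)) (s : seq T) :
    mxpair F (sumn (map r s)) (sumn (map c s)) :=
  match s with
  | [::] => (0, 0)
  | x :: s' => dsum2 (P x) (dsum P s')
  end.

(* The size of a direct sum is only provably equal to that of the pair it is
   compared with, so congruence and equivalence relate pairs whose sizes are
   equal propositionally and transport along these equalities. *)
Definition congruent (F : fieldType) m n
    (P : mxpair F m m) (Q : mxpair F n n) : Prop :=
  exists (e : m = n) (S : 'M[F]_n),
    [/\ S \in unitmx,
        S^T *m castmx (e, e) P.1 *m S = Q.1
      & S^T *m castmx (e, e) P.2 *m S = Q.2].

Definition equivalent (F : fieldType) m n m' n'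
    (P : mxpair F m n) (Q : mxpair F m' n') : Prop :=
  exists (er : m = m') (ec : n = n') (R : 'M[F]_m') (S : 'M[F]_n'),
    [/\ R \in unitmx, S \in unitmx,
        R *m castmx (er, ec) P.1 *m S = Q.1
      & R *m castmx (er, ec) P.2 *m S = Q.2].

(* F_n = [I_n | 0] and G_n = [0 | I_n] *)
Definition kroF (F : fieldType) n : 'M[F]_(n, n.+1) :=
  \matrix_(i, j) (j == i :> nat)%:R.
Definition kroG (F : fieldType) n : 'M[F]_(n, n.+1) :=
  \matrix_(i, j) (j == i.+1 :> nat)%:R.

(* Kronecker summands. The parameter of KroJ and KroJinf is the size minus 1,
   which rules out the 0 x 0 summands; that of KroFG and KroFGT is n >= 0.
     KroJ n lam |-> (I_(n+1), J_(n+1)(lam))      KroFG n  |-> (F_n, G_n)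
     KroJinf n  |-> (J_(n+1)(0), I_(n+1))        KroFGT n |-> (F_n^T, G_n^T) *)
Inductive kro_summand (F : Type) : Type :=
  | KroJ of nat & F
  | KroJinf of nat
  | KroFG of nat
  | KroFGT of nat.
Arguments KroJinf {F}.
Arguments KroFG {F}.
Arguments KroFGT {F}.

Definition kro_rows (F : Type) (x : kro_summand F) : nat :=
  match x with
  | KroJ n _ => n.+1
  | KroJinf n => n.+1
  | KroFG n => n
  | KroFGT n => n.+1
  end.

Definition kro_cols (F : Type) (x : kro_summand F) : nat :=
  match x with
  | KroJ n _ => n.+1
  | KroJinf n => n.+1
  | KroFG n => n.+1
  | KroFGT n => n
  end.

Definition kro_pair (F : fieldType) (x : kro_summand F) :
    mxpair F (kro_rows x) (kro_cols x) :=
  match x with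
  | KroJ n lam => (1%:M, jordan_block n.+1 lam)
  | KroJinf n => (jordan_block n.+1 0, 1%:M)
  | KroFG n => (kroF F n, kroG F n)
  | KroFGT n => ((kroF F n)^T, (kroG F n)^T)
  end.

(* c lists the summands of a Kronecker canonical form of P; over an
   algebraically closed field such a c exists and is unique up to permutation,
   by Kronecker's theorem. *)
Definition is_KCF (F : fieldType) m n
    (P : mxpair F m n) (c : seq (kro_summand F)) : Prop :=
  equivalent P (dsum (@kro_pair F) c).

(* With 0-based i, position (i, i+1) is position (j, j+1) for j = i + 1; the
   entry is 1 in the first matrix when j is odd, in the second when j is even. *)
Definition path_pair (F : fieldType) k : mxpair F k.*2.+1 k.*2.+1 :=
  (\matrix_(i, j) ((j == i.+1 :> nat) && ~~ odd i
                   || (i == j.+1 :> nat) && ~~ odd j)%:R,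
   \matrix_(i, j) ((j == i.+1 :> nat) && odd i
                   || (i == j.+1 :> nat) && odd j)%:R).

(* Symmetric summands. The parameter of SymJ and SymJinf is the size minus 1,
   that of SymPath is k >= 0. Distinct labels give distinct pairs of matrices,
   so permuting labels is the same as permuting summands.
     SymJ n lam |-> (I_(n+1), lam I_(n+1) + N_(n+1))
     SymJinf n  |-> (N_(n+1), I_(n+1)) *)
Inductive sym_summand (F : Type) : Type :=
  | SymJ of nat & F
  | SymJinf of nat
  | SymPath of nat.
Arguments SymJinf {F}.
Arguments SymPath {F}.

Section SymSummandEqType.
Variable F : Type.

Definition sym_encode (x : sym_summand F) : (nat * F) + (nat + nat) :=
  match x with
  | SymJ n lam => inl (n, lam)
  | SymJinf n => inr (inl n)
  | SymPath k => inr (inr k)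
  end.

Definition sym_decode (y : (nat * F) + (nat + nat)) : sym_summand F :=
  match y with
  | inl (n, lam) => SymJ n lam
  | inr (inl n) => SymJinf n
  | inr (inr k) => SymPath k
  end.

Lemma sym_encodeK : cancel sym_encode sym_decode.
Proof. by case. Qed.
End SymSummandEqType.

HB.instance Definition _ (F : eqType) :=
  Equality.copy (sym_summand F) (can_type (@sym_encodeK F)).

Section KroSummandEqType.
Variable F : Type.

Definition kro_encode (x : kro_summand F) : (nat * F) + (nat + (nat + nat)) :=
  match x with
  | KroJ n lam => inl (n, lam)
  | KroJinf n => inr (inl n)
  | KroFG n => inr (inr (inl n))
  | KroFGT n => inr (inr (inr n))
  end.

Definition kro_decode (y : (nat * F) + (nat + (nat + nat))) : kro_summand F :=
  match y with
  | inl (n, lam) => KroJ n lam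
  | inr (inl n) => KroJinf n
  | inr (inr (inl n)) => KroFG n
  | inr (inr (inr n)) => KroFGT n
  end.

Lemma kro_encodeK : cancel kro_encode kro_decode.
Proof. by case. Qed.
End KroSummandEqType.

HB.instance Definition _ (F : eqType) :=
  Equality.copy (kro_summand F) (can_type (@kro_encodeK F)).

Definition sym_size (F : Type) (x : sym_summand F) : nat :=
  match x with
  | SymJ n _ => n.+1
  | SymJinf n => n.+1
  | SymPath k => k.*2.+1
  end.

Definition sym_pair (F : fieldType) (N : forall n, 'M[F]_n)
    (x : sym_summand F) : mxpair F (sym_size x) (sym_size x) :=
  match x with
  | SymJ n lam => (1%:M, lam%:M + N n.+1)
  | SymJinf n => (N n.+1, 1%:M)
  | SymPath k => path_pair F k
  end.

(* Main.v *)
Require Import Defs.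
From HB Require Import structures.
From mathcomp Require Import all_boot all_order all_algebra.
From mathcomp Require Import zify ring.

Set Implicit Arguments.
Unset Strict Implicit.
Unset Printing Implicit Defensive.

Import GRing.Theory.
Local Open Scope ring_scope.

(**
Two symmetric pairs over an algebraically closed field of characteristic not 2
that are equivalent are congruent: if R A S = A' and R B S = B', then
M = S^-T R satisfies M A = A M^T and M B = B M^T, hence so does every
polynomial in M; a square root K of M that is a polynomial in M gives
(K^T S)^T A (K^T S) = A', and the same for B.

By Kronecker's theorem it remains to match canonical forms. Transposition
preserves a symmetric pair and exchanges (F_k, G_k) with (F_k^T, G_k^T), so these
two blocks have the same multiplicity and are grouped into the blocks (iii).

Existence in Kronecker's theorem: if A is not surjective, then up to equivalence
either a zero row splits off or A = [A1 a; 0 0] and B = [B1 0; 0 I] with [A1 a]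
surjective; a decomposition of the smaller pair (A1, B1) extends to one of
(A, B). Transposition covers the case of A not injective, and the same step
applied to (M - lambda I, I) gives the Jordan form, which settles the case of A
invertible.

Uniqueness: the dimension of {V | P1 V Q1 = P2 V Q2} is an invariant of the pair
P, additive over direct sums; with Q ranging over Kronecker blocks it determines
the multiplicities of the summands of P.
*)

(** * Equivalence without casts *)

Section Equivalence.
Variable F : fieldType.

(** The two sizes are kept apart, although [inverse_mx_dim] forces them to be equal: a change of
    basis can then relate sizes that are only provably equal. *)
Definition inverse_mx m n (R : 'M[F]_(m, n)) (R' : 'M[F]_(n, m)) : Prop :=
  R *m R' = 1%:M /\ R' *m R = 1%:M.

Lemma inverse_mx1 n : inverse_mx (1%:M : 'M[F]_n) 1%:M.
Proof. by split; rewrite mulmx1. Qed.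

Lemma inverse_mx_sym m n (R : 'M[F]_(m, n)) R' :
  inverse_mx R R' -> inverse_mx R' R.
Proof. by case. Qed.

Lemma inverse_mx_mul m n p (R : 'M[F]_(m, n)) R' (S : 'M[F]_(n, p)) S' :
  inverse_mx R R' -> inverse_mx S S' -> inverse_mx (R *m S) (S' *m R').
Proof.
move=> [r1 r2] [s1 s2]; split.
  by rewrite mulmxA -(mulmxA R) s1 mulmx1.
by rewrite mulmxA -(mulmxA S') r2 mulmx1.
Qed.

Lemma inverse_mx_tr m n (R : 'M[F]_(m, n)) R' :
  inverse_mx R R' -> inverse_mx R^T R'^T.
Proof. by move=> [r1 r2]; split; rewrite -trmx_mul ?r1 ?r2 trmx1. Qed.

Lemma inverse_mx_dim m n (R : 'M[F]_(m, n)) R' : inverse_mx R R' -> m = n.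
Proof.
by move=> [/mulmx1_min r1 /mulmx1_min r2]; apply/eqP; rewrite eqn_leq r1 r2.
Qed.

Lemma inverse_mx_unit n (R : 'M[F]_n) : R \in unitmx -> inverse_mx R (invmx R).
Proof. by move=> uR; split; rewrite (mulmxV, mulVmx). Qed.

Lemma inverse_mx_diag m n m' n' (R : 'M[F]_(m, n)) R' (S : 'M[F]_(m', n')) S' :
  inverse_mx R R' -> inverse_mx S S' ->
  inverse_mx (block_mx R 0 0 S) (block_mx R' 0 0 S').
Proof.
move=> [r1 r2] [s1 s2]; split;
by rewrite mulmx_block !(mulmx0, mul0mx, addr0, add0r) ?r1 ?r2 ?s1 ?s2
           -scalar_mx_block.
Qed.

Lemma inverse_mx_shear m n (X : 'M[F]_(m, n)) :
  inverse_mx (block_mx 1%:M X 0 1%:M) (block_mx 1%:M (- X) 0 1%:M).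
Proof.
by split; rewrite mulmx_block !(mulmx0, mul0mx, addr0, add0r, mulmx1, mul1mx)
  (addNr, addrN) -scalar_mx_block.
Qed.

Definition eqv m n m' n' (P : mxpair F m n) (Q : mxpair F m' n') : Prop :=
  exists (R : 'M[F]_(m', m)) R' (S : 'M[F]_(n, n')) S',
    [/\ inverse_mx R R', inverse_mx S S',
        R *m P.1 *m S = Q.1 & R *m P.2 *m S = Q.2].

Lemma equivalentP m n m' n' (P : mxpair F m n) (Q : mxpair F m' n') :
  equivalent P Q <-> eqv P Q.
Proof.
split.
  case=> er [ec [R [S [uR uS e1 e2]]]]; subst m' n'.
  rewrite !castmx_id in e1 e2.
  by exists R, (invmx R), S, (invmx S); split=> //; apply: inverse_mx_unit.
case=> [R [R' [S [S' [iR iS e1 e2]]]]].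
have em := inverse_mx_dim iR; have en := inverse_mx_dim iS.
subst m' n'; exists erefl, erefl, R, S; rewrite !castmx_id; split=> //.
  by case: iR => /mulmx1_unit[].
by case: iS => /mulmx1_unit[].
Qed.

Lemma eqv_refl m n (P : mxpair F m n) : eqv P P.
Proof.
by exists 1%:M, 1%:M, 1%:M, 1%:M; split; rewrite ?mul1mx ?mulmx1 //;
   apply: inverse_mx1.
Qed.

Lemma eqv_sym m n m' n' (P : mxpair F m n) (Q : mxpair F m' n') :
  eqv P Q -> eqv Q P.
Proof.
move=> [R [R' [S [S' [iR iS e1 e2]]]]].
exists R', R, S', S; split; try exact: inverse_mx_sym.
  by rewrite -e1 !mulmxA iR.2 mul1mx -mulmxA iS.1 mulmx1.
by rewrite -e2 !mulmxA iR.2 mul1mx -mulmxA iS.1 mulmx1.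
Qed.

Lemma eqv_trans m n m' n' m'' n'' (P : mxpair F m n) (Q : mxpair F m' n')
    (T : mxpair F m'' n'') : eqv P Q -> eqv Q T -> eqv P T.
Proof.
move=> [R [R' [S [S' [iR iS e1 e2]]]]] [U [U' [V [V' [iU iV f1 f2]]]]].
exists (U *m R), (R' *m U'), (S *m V), (V' *m S').
by split; [exact: inverse_mx_mul..| |]; rewrite -(f1, f2) -(e1, e2) !mulmxA.
Qed.

Lemma eqv_mul m n m' n' (A B : 'M[F]_(m, n)) (R : 'M[F]_(m', m)) R'
    (S : 'M[F]_(n, n')) S' :
  inverse_mx R R' -> inverse_mx S S' ->
  eqv (A, B) (R *m A *m S, R *m B *m S).
Proof. by move=> iR iS; exists R, R', S, S'. Qed.

(** Replaces casts: entries are compared through the natural numbers underlying their indices. *)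
Lemma eqv_entries m n m' n' (P : mxpair F m n) (Q : mxpair F m' n') :
  m = m' -> n = n' ->
  (forall (i : 'I_m) (j : 'I_n) (i' : 'I_m') (j' : 'I_n'),
     i = i' :> nat -> j = j' :> nat ->
     P.1 i j = Q.1 i' j' /\ P.2 i j = Q.2 i' j') ->
  eqv P Q.
Proof.
move=> em en; subst m' n'; case: P Q => [A B] [A' B'] /= h.
have -> : A = A' by apply/matrixP=> i j; case: (h i j i j).
have -> : B = B' by apply/matrixP=> i j; case: (h i j i j).
exact: eqv_refl.
Qed.

Lemma eqv_dsum2 m n m' n' p q p' q' (P : mxpair F m n) (P' : mxpair F m' n')
    (Q : mxpair F p q) (Q' : mxpair F p' q') :
  eqv P P' -> eqv Q Q' -> eqv (dsum2 P Q) (dsum2 P' Q').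
Proof.
move=> [R [R' [S [S' [iR iS e1 e2]]]]] [U [U' [V [V' [iU iV f1 f2]]]]].
exists (block_mx R 0 0 U), (block_mx R' 0 0 U').
exists (block_mx S 0 0 V), (block_mx S' 0 0 V').
split; [exact: inverse_mx_diag..| |];
by rewrite /= !mulmx_block !(mulmx0, mul0mx, addr0, add0r) (e1, e2) (f1, f2).
Qed.

Lemma dsum2A m n m' n' p q (P : mxpair F m n) (P' : mxpair F m' n')
    (Q : mxpair F p q) : eqv (dsum2 P (dsum2 P' Q)) (dsum2 (dsum2 P P') Q).
Proof.
apply: eqv_entries; rewrite ?addnA // => i j i' j' ei ej /=.
have h X Y Z := @block_mxA F m m' p n n' q X 0 0 0 Y 0 0 0 Z.
rewrite /= !row_mx0 !col_mx0 in h; rewrite !h !castmxE /=.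
by split; congr (block_mx _ _ _ _ _ _); apply: val_inj.
Qed.

Lemma dsum2C m n m' n' (P : mxpair F m n) (Q : mxpair F m' n') :
  eqv (dsum2 P Q) (dsum2 Q P).
Proof.
exists (block_mx 0 1%:M 1%:M 0), (block_mx 0 1%:M 1%:M 0).
exists (block_mx 0 1%:M 1%:M 0), (block_mx 0 1%:M 1%:M 0).
split; first 2 last; rewrite /= ?mulmx_block;
  rewrite ?(mulmx0, mul0mx, addr0, add0r, mulmx1, mul1mx) //;
split; by rewrite mulmx_block ?(mulmx0, mul0mx, addr0, add0r, mulmx1, mul1mx)
   -scalar_mx_block.
Qed.

Lemma dsum2CA m n m' n' p q (P : mxpair F m n) (P' : mxpair F m' n')
    (Q : mxpair F p q) : eqv (dsum2 P (dsum2 P' Q)) (dsum2 P' (dsum2 P Q)).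
Proof.
apply: eqv_trans (dsum2A _ _ _) _; apply: eqv_sym.
apply: eqv_trans (dsum2A _ _ _) _.
exact: eqv_dsum2 (dsum2C _ _) (eqv_refl _).
Qed.

Section DirectSum.
Variables (T : Type) (r c : T -> nat) (P : forall x, mxpair F (r x) (c x)).

Lemma dsum_map U (r' c' : U -> nat) (Q : forall y, mxpair F (r' y) (c' y))
    (f : T -> U) s :
  (forall x, eqv (P x) (Q (f x))) -> eqv (dsum P s) (dsum Q (map f s)).
Proof.
move=> PQ; elim: s => [|x s IHs] /=; first exact: eqv_refl.
exact: eqv_dsum2.
Qed.

Lemma dsum_cat s t : eqv (dsum P (s ++ t)) (dsum2 (dsum P s) (dsum P t)).
Proof.
elim: s => [|x s IHs] /=.
  apply: eqv_entries => // i j i' j' ei ej /=; rewrite /block_mx.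
  have -> : i' = rshift 0 i by apply: val_inj.
  have -> : j' = rshift 0 j by apply: val_inj.
  by rewrite !col_mxEd !row_mxEr.
exact: eqv_trans (eqv_dsum2 (eqv_refl _) IHs) (dsum2A _ _ _).
Qed.

Lemma dsum_flatten U (r' c' : U -> nat) (Q : forall y, mxpair F (r' y) (c' y))
    (f : U -> seq T) s :
  (forall y, eqv (Q y) (dsum P (f y))) ->
  eqv (dsum Q s) (dsum P (flatten (map f s))).
Proof.
move=> PQ; elim: s => [|y s IHs] /=; first exact: eqv_refl.
exact: eqv_trans (eqv_dsum2 (PQ y) IHs) (eqv_sym (dsum_cat _ _)).
Qed.
End DirectSum.

Lemma dsum_perm (T : eqType) (r c : T -> nat)
    (P : forall x, mxpair F (r x) (c x)) (s t : seq T) :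
  perm_eq s t -> eqv (dsum P s) (dsum P t).
Proof.
elim: s t => [|x s IHs] t.
  by rewrite perm_sym => /perm_nilP->; apply: eqv_refl.
move=> st; have /path.splitPr : x \in t by rewrite -(perm_mem st) mem_head.
move=> tt; case: tt st => t1 t2 st.
have {st} st : perm_eq s (t1 ++ t2).
  by rewrite -(perm_cons x) (permPl st) -cat1s perm_catCA.
apply: eqv_trans (eqv_dsum2 (eqv_refl _) (IHs _ st)) _ => {IHs st}.
elim: t1 => [|y t1 IHt] /=; first exact: eqv_refl.
exact: eqv_trans (dsum2CA _ _ _) (eqv_dsum2 (eqv_refl _) IHt).
Qed.
End Equivalence.

(** * One-step extensions *)

Section Extension.
Variable F : fieldType.

Definition blockE := (mulmx_block, mulmx0, mul0mx, mulmx1, mul1mx,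
  @addr0, @add0r).

(** Elimination gives [B = L [I 0] U] with [L] and [U] invertible, so [g = U^-1 diag(L^-1, I)]
    does. *)
Lemma row_free_normal k n (B : 'M[F]_(k, n)) :
  row_free B -> exists c (g : 'M[F]_(n, k + c)) g',
    inverse_mx g g' /\ B *m g = row_mx 1%:M 0.
Proof.
move=> fB; have kn : (k <= n)%N by rewrite -(eqP fB) rank_leq_col.
have en : n = (k + (n - k))%N by rewrite subnKC.
move: (n - k)%N en => c en; subst n; exists c.
pose L := col_ebase B; pose U := row_ebase B.
have iU : inverse_mx (invmx U) U.
  by apply/inverse_mx_sym/inverse_mx_unit/row_ebase_unit.
have iL : inverse_mx (invmx L) L.
  by apply/inverse_mx_sym/inverse_mx_unit/col_ebase_unit.
have iD := inverse_mx_diag iL (inverse_mx1 F c).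
eexists _, _; split; first exact: inverse_mx_mul iU iD.
rewrite -{1}[B]mulmx_ebase (eqP fB) -/L -/U pid_mx_row !mulmxA.
rewrite -(mulmxA _ U) iU.2 mulmx1 mul_mx_row mulmx0 mulmx1.
by rewrite mul_row_block !(mulmx0, mul0mx, addr0) iL.2.
Qed.

Lemma inverse_mx_swap m n :
  inverse_mx (block_mx 0 1%:M 1%:M 0 : 'M[F]_(m + n, n + m))
             (block_mx 0 1%:M 1%:M 0).
Proof. by split; rewrite !blockE -scalar_mx_block. Qed.

Lemma row_free_normalr k n (B : 'M[F]_(k, n)) :
  row_free B -> exists c (g : 'M[F]_(n, c + k)) g',
    inverse_mx g g' /\ B *m g = row_mx 0 1%:M.
Proof.
move=> /row_free_normal[c [g [g' [ig Bg]]]]; exists c; do 2!eexists.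
split; first exact: inverse_mx_mul ig (inverse_mx_swap _ _).
by rewrite mulmxA Bg mul_row_block !(mulmx0, mulmx1, addr0, add0r).
Qed.

Lemma not_row_freeP m n (A : 'M[F]_(m, n)) :
  ~~ row_free A -> exists2 v : 'rV_m, v != 0 & v *m A = 0.
Proof.
rewrite -kermx_eq0 => /rowV0Pn[v /sub_kermxP vA v0]; by exists v.
Qed.

Lemma rV_row_free n (v : 'rV[F]_n) : v != 0 -> row_free v.
Proof. by rewrite /row_free rank_rV => ->. Qed.

Lemma row_free_mul m n p (A : 'M[F]_(m, n)) (S : 'M[F]_(n, p)) S' :
  inverse_mx S S' -> row_free (A *m S) = row_free A.
Proof.
move=> [e1 e2]; apply/idP/idP=> /row_freeP[B AB]; apply/row_freeP.
  by exists (S *m B); rewrite mulmxA.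
by exists (S' *m B); rewrite mulmxA -(mulmxA A) e1 mulmx1.
Qed.

Lemma row_free_mull m n p (A : 'M[F]_(m, n)) (R : 'M[F]_(p, m)) R' :
  inverse_mx R R' -> row_free (R *m A) = row_free A.
Proof.
move=> [e1 e2]; apply/idP/idP=> /row_freeP[B AB]; apply/row_freeP.
  exists (B *m R); rewrite mulmxA.
  by rewrite -[A *m B]mul1mx -e2 -!mulmxA (mulmxA R) (mulmxA (R *m A)) AB mul1mx.
by exists (B *m R'); rewrite mulmxA -(mulmxA R) AB mulmx1.
Qed.

(** The shape that [not_row_free_ext] produces; the identity block matches the new rows with the new
    columns. *)
Definition ext m n w (P : mxpair F m n) (a : 'M[F]_(m, w)) :
    mxpair F (m + w) (n + w) :=
  (block_mx P.1 a 0 0, block_mx P.2 0 0 1%:M).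

Lemma ext_congr m n m' n' w w' (P : mxpair F m n) (a : 'M[F]_(m, w))
    (R : 'M[F]_(m', m)) R' (S : 'M[F]_(n, n')) S' (g : 'M[F]_(w, w')) g' :
  inverse_mx R R' -> inverse_mx S S' -> inverse_mx g g' ->
  eqv (ext P a) (ext (R *m P.1 *m S, R *m P.2 *m S) (R *m a *m g)).
Proof.
move=> iR iS ig.
exists (block_mx R 0 0 g'), (block_mx R' 0 0 g).
exists (block_mx S 0 0 g), (block_mx S' 0 0 g').
split; [| exact: inverse_mx_diag | |].
- exact/inverse_mx_diag/inverse_mx_sym.
- by rewrite /= !blockE.
- by rewrite /= !blockE ig.2.
Qed.

Lemma ext_eqv m n m' n' w (P : mxpair F m n) (Q : mxpair F m' n')
    (a : 'M[F]_(m, w)) : eqv P Q ->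
  row_free (row_mx P.1 a) ->
  exists b : 'M[F]_(m', w),
    eqv (ext P a) (ext Q b) /\ row_free (row_mx Q.1 b).
Proof.
move=> [R [R' [S [S' [iR iS e1 e2]]]]] Pa.
exists (R *m a); split.
  have := ext_congr P a iR iS (inverse_mx1 F w).
  by rewrite mulmx1 e1 e2 -surjective_pairing.
pose D : 'M_(n + w, n' + w) := block_mx S 0 0 1%:M.
have -> : row_mx Q.1 (R *m a) = R *m (row_mx P.1 a *m D).
  by rewrite mul_row_block !blockE mul_mx_row mulmxA e1.
rewrite (row_free_mull _ iR).
by rewrite (row_free_mul _ (inverse_mx_diag iS (inverse_mx1 F w))).
Qed.

(** Adding [P.1 *m X] to [a] by a column operation creates [P.2 *m X] above the identity block. The
    new rows clear it, and they are zero in the first component. *)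
Lemma ext_shift m n w (P : mxpair F m n) (a : 'M[F]_(m, w)) X :
  eqv (ext P a) (ext P (a + P.1 *m X)).
Proof.
exists (block_mx 1%:M (- (P.2 *m X)) 0 1%:M).
exists (block_mx 1%:M (- - (P.2 *m X)) 0 1%:M).
exists (block_mx 1%:M X 0 1%:M), (block_mx 1%:M (- X) 0 1%:M).
split; try exact: inverse_mx_shear.
  by rewrite /= !blockE addrC.
by rewrite /= !blockE addrN.
Qed.

Lemma row_free_shift m n w (A : 'M[F]_(m, n)) (a : 'M[F]_(m, w)) X :
  row_free (row_mx A (a + A *m X)) = row_free (row_mx A a).
Proof.
rewrite -(row_free_mul (row_mx A a) (inverse_mx_shear X)).
by rewrite mul_row_block !blockE addrC.
Qed.

Lemma ext_dsum2 m n w m' n' w' (P : mxpair F m n) (a : 'M[F]_(m, w))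
    (Q : mxpair F m' n') (b : 'M[F]_(m', w')) :
  eqv (ext (dsum2 P Q) (block_mx a 0 0 b)) (dsum2 (ext P a) (ext Q b)).
Proof.
(* [s] exchanges the two middle blocks of coordinates. *)
pose s m n p q : 'M[F]_((m + n) + (p + q), (m + p) + (n + q)) :=
  block_mx (block_mx 1%:M 0 0 0) (block_mx 0 0 1%:M 0)
           (block_mx 0 1%:M 0 0) (block_mx 0 0 0 1%:M).
have is_ x y p q : inverse_mx (s x y p q) (s x p y q).
  by split; rewrite /s !(blockE, add_block_mx, block_mx0) -!scalar_mx_block.
exists (s m w m' w'), (s m m' w w'), (s n n' w w'), (s n w n' w').
split; try exact: is_.
all: by rewrite /s /= !(blockE, add_block_mx, block_mx0).
Qed.

Lemma ext0 m n (P : mxpair F m n) (a : 'M[F]_(m, 0)) : eqv (ext P a) P.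
Proof.
apply: eqv_entries; rewrite ?addn0 // => i j i' j' ei ej /=.
have -> : i = lshift 0 i' by apply: val_inj.
have -> : j = lshift 0 j' by apply: val_inj.
by rewrite !block_mxEul.
Qed.
End Extension.

(** * Extensions of direct sums *)

Section ExtDecomposition.
Variable F : fieldType.

Lemma row_free_kernel m n (A : 'M[F]_(m, n)) (v : 'rV_m) :
  row_free A -> v *m A = 0 -> v = 0.
Proof. by move=> fA vA; apply: (row_free_inj fA); rewrite mul0mx. Qed.

Variables (T : Type) (r c : T -> nat) (P : forall x, mxpair F (r x) (c x)).
Variable x0 : T.
Hypothesis P_x0 : eqv ((0 : 'M[F]_1, 1%:M) : mxpair F 1 1) (P x0).
(** A summand that is not surjective lacks exactly one dimension, and supplying it gives a summand
    again. *)
Hypothesis P_ext : forall x, ~~ row_free (P x).1 ->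
  exists (a : 'cV[F]_(r x)) x',
    row_free (row_mx (P x).1 a) /\ eqv (ext (P x) a) (P x').

Lemma dsum_nilpotent1 w :
  eqv ((0 : 'M[F]_w, 1%:M) : mxpair F w w) (dsum P (nseq w x0)).
Proof.
elim: w => [|w IHw] /=.
  by apply: eqv_entries => // -[].
apply: eqv_trans (eqv_dsum2 P_x0 IHw); rewrite /dsum2 /=.
by rewrite -scalar_mx_block block_mx0; apply: eqv_refl.
Qed.

(* [ext_shift] clears the part of [a] over the image of the first component;
   then each summand with nonzero cokernel absorbs one column and grows by one
   step, and every column left over gives a summand [(0, 1)]. *)
Lemma ext_dsum s w (a : 'M[F]_(sumn (map r s), w)) :
  row_free (row_mx (dsum P s).1 a) ->
  exists s', eqv (ext (dsum P s) a) (dsum P s').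
Proof.
elim: s w a => [|x s IHs] w /= a fa.
  exists (nseq w x0); apply: eqv_trans (dsum_nilpotent1 w).
  apply: eqv_entries => // i j i' j' ei ej /=.
  have -> : i = rshift 0 i' by apply: val_inj.
  have -> : j = rshift 0 j' by apply: val_inj.
  by rewrite !block_mxEdr mxE.
rewrite -[a]vsubmxK in fa *; move: (usubmx a) (dsubmx a) fa => {a} a1 a2.
set A1 := (P x).1; set A2 := (dsum P s).1.
case: (boolP (row_free A1)) => [/row_freeP[X AX] | nfx] fa.
  pose Y : 'M_(c x + sumn (map c s), w) := col_mx (- (X *m a1)) 0.
  have eY : col_mx a1 a2 + (dsum2 (P x) (dsum P s)).1 *m Y
      = col_mx 0 a2.
    rewrite /= mul_block_col !blockE mulmxN mulmxA AX mul1mx.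
    by rewrite add_col_mx addrN addr0.
  (* All new columns go to [s]; [P x] gets a block of width 0, which [ext0] removes. *)
  have e0 : col_mx 0 a2 = block_mx (0 : 'M_(r x, 0)) 0 0 a2.
    by rewrite /block_mx !row_thin_mx.
  have /IHs[s' es'] : row_free (row_mx A2 a2).
    move: fa; rewrite -(row_free_shift _ _ Y) [_ + _]eY => fa.
    apply: inj_row_free => y; rewrite mul_mx_row -row_mx0 => /eq_row_mx[y1 y2].
    have := row_free_kernel fa (v := row_mx 0 y).
    rewrite mul_mx_row mul_row_block mul_row_col !blockE y1 y2 !row_mx0.
    by move=> /(_ erefl); rewrite -row_mx0 => /eq_row_mx[].
  exists (x :: s'); apply: eqv_trans (ext_shift _ _ Y) _; rewrite eY e0.
  exact: eqv_trans (ext_dsum2 _ _ _ _) (eqv_dsum2 (ext0 _ _) es').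
have [b [x' [fb ext_x]]] := P_ext nfx.
have [z z0 zA] := not_row_freeP nfx.
have zb0 : z *m b != 0.
  apply: contraNneq z0 => zb; apply/eqP; apply: (row_free_kernel fb).
  by rewrite mul_mx_row zA zb row_mx0.
have [X AX] := row_freeP fb.
(* The image of [A1] and the column [b] span everything, so modulo that image every column of [a1]
   is a multiple of [b]; [al] lists the coefficients. *)
have [X1 [al ea1]] : exists X1 (al : 'rV_w), a1 = A1 *m X1 + b *m al.
  exists (usubmx (X *m a1)), (dsubmx (X *m a1)).
  by rewrite -mul_row_col vsubmxK mulmxA AX mul1mx.
pose Y : 'M_(c x + sumn (map c s), w) := col_mx (- X1) 0.
have eY : col_mx a1 a2 + (dsum2 (P x) (dsum P s)).1 *m Y
    = col_mx (b *m al) a2.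
  rewrite /= mul_block_col !blockE mulmxN ea1 add_col_mx addr0.
  by rewrite [A1 *m _ + _]addrC addrK.
have al_free : row_free al.
  apply: rV_row_free; apply: contraNneq z0 => al0.
  move: fa; rewrite -(row_free_shift _ _ Y) [_ + _]eY al0 mulmx0 => fa.
  have := row_free_kernel fa (v := row_mx z 0).
  rewrite mul_mx_row mul_row_block mul_row_col !blockE zA !row_mx0 => /(_ erefl).
  by rewrite -row_mx0 => /eq_row_mx[->].
have [w' [g [g' [ig alg]]]] := row_free_normal al_free.
pose e := lsubmx (a2 *m g); pose a3 := rsubmx (a2 *m g).
have iD := inverse_mx_diag (inverse_mx1 F (c x + sumn (map c s))) ig.
have eg : col_mx (b *m al) a2 *m g = block_mx b 0 e a3.
  rewrite mul_col_mx -mulmxA alg mul_mx_row mulmx1 mulmx0 -[a2 *m g]hsubmxK.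
  by rewrite /block_mx.
have {}fa : row_free (row_mx (block_mx A1 0 0 A2) (block_mx b 0 e a3)).
  move: fa; rewrite -(row_free_shift _ _ Y) [_ + _]eY -(row_free_mul _ iD).
  by rewrite mul_row_block !blockE eg.
have fa3 : row_free (row_mx A2 a3).
  apply: inj_row_free => y; rewrite mul_mx_row -row_mx0 => /eq_row_mx[y1 y2].
  (* With this [k] the row [(k z, y)] annihilates the column [[b; e]] too, hence the whole
     matrix. *)
  pose k := - ((y *m e) 0 0 / (z *m b) 0 0).
  have := row_free_kernel fa (v := row_mx (k *: z) y).
  rewrite mul_mx_row !mul_row_block !blockE y1 y2 -!scalemxAl zA scaler0.
  have -> : k *: (z *m b) + y *m e = 0.
    rewrite /k; move: (z *m b) (y *m e) zb0 => u t u0.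
    apply/matrixP=> i j; rewrite !ord1 !mxE mulNr divfK ?addNr //.
    apply: contraNneq u0 => u00; apply/eqP/matrixP=> i' j'.
    by rewrite !ord1 u00 mxE.
  rewrite !row_mx0 => /(_ erefl).
  by rewrite -row_mx0 => /eq_row_mx[].
have [Z AZ] := row_freeP fa3.
have [s' es'] := IHs _ _ fa3.
pose X3 := usubmx (Z *m e); pose X4 := dsubmx (Z *m e).
(* The part [a3 *m X4] of [e] is cleared by an operation among the new columns, the part [A2 *m X3]
   by [ext_shift]. *)
have ee : e = A2 *m X3 + a3 *m X4 by rewrite -mul_row_col vsubmxK mulmxA AZ mul1mx.
exists (x' :: s'); apply: eqv_trans (ext_shift _ _ Y) _; rewrite eY.
have iS : inverse_mx (block_mx 1%:M 0 (- X4) 1%:M : 'M_(1 + w'))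
                     (block_mx 1%:M 0 X4 1%:M).
  by split; rewrite !blockE (addNr, addrN) -scalar_mx_block.
have i1 n := inverse_mx1 F n.
apply: eqv_trans (ext_congr _ _ (i1 _) (i1 _) (inverse_mx_mul ig iS)) _.
rewrite !mul1mx !mulmx1 mulmxA eg mulmx_block !blockE ?mulmxN.
apply: eqv_trans (ext_shift _ _ (block_mx 0 0 (- X3) 0)) _.
rewrite /= mulmx_block !blockE add_block_mx !addr0 mulmxN ee addrK addrN.
exact: eqv_trans (ext_dsum2 _ _ _ _) (eqv_dsum2 ext_x es').
Qed.
End ExtDecomposition.

(** * Reduction of pairs whose first component is not surjective *)

Section Reduction.
Variable F : fieldType.

(** [v] is completed to a basis of the row space, and the row it stands for is zero in both
    components. *)
Lemma split_zero_row m n (A B : 'M[F]_(m, n)) (v : 'rV_m) :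
  v != 0 -> v *m A = 0 -> v *m B = 0 ->
  exists m' (Q : mxpair F m' n),
    m = m'.+1 /\ eqv (A, B) (dsum2 ((0, 0) : mxpair F 1 0) Q).
Proof.
move=> v0 vA vB.
have [m' [g [g' [ig vg]]]] := row_free_normal (rV_row_free v0).
have vg' : usubmx g' = v.
  have : v = row_mx 1%:M 0 *m g' by rewrite -vg -mulmxA ig.1 mulmx1.
  by rewrite -{1}[g']vsubmxK mul_row_col mul1mx mul0mx addr0 => ->.
exists m', (dsubmx g' *m A, dsubmx g' *m B); split.
  exact: inverse_mx_dim ig.
apply: eqv_trans (eqv_mul _ _ (inverse_mx_sym ig) (inverse_mx1 F n)) _.
rewrite /dsum2 /block_mx /= !row_thin_mx !mulmx1 -[g']vsubmxK !mul_col_mx vg'.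
by rewrite vA vB col_mxKd; apply: eqv_refl.
Qed.

Lemma col_mx_rank m n (A : 'M[F]_(m, n)) :
  exists w (R : 'M[F]_(\rank A + w, m)) R' (A' : 'M_(\rank A, n)),
    [/\ inverse_mx R R', R *m A = col_mx A' 0 & row_free A'].
Proof.
have : row_free (col_base A)^T by rewrite /row_free mxrank_tr; apply: col_base_full.
move=> /row_free_normal[w [g [g' [ig Ag]]]].
exists w, g^T, g'^T, (row_base A); split; last exact: row_base_free.
  exact: inverse_mx_tr.
have -> : g^T *m A = g^T *m col_base A *m row_base A.
  by rewrite -mulmxA mulmx_base.
rewrite -[g^T *m _]trmxK trmx_mul trmxK Ag.
by rewrite tr_row_mx trmx1 trmx0 mul_col_mx mul1mx mul0mx.
Qed.

(** Row operations bring [A] to [[A'; 0]]. If the rows of [B] facing the zero rows are independent,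
    column operations turn them into [[0 I]] and a row operation clears the block above [I]; a
    dependency among them annihilates both [A] and [B]. As [0 < w], the remaining pair is
    smaller. *)
Lemma not_row_free_ext m n (A B : 'M[F]_(m, n)) :
  ~~ row_free A ->
  (exists2 v : 'rV_m, v != 0 & v *m A = 0 /\ v *m B = 0) \/
  exists m' n' w (P : mxpair F m' n') (a : 'M_(m', w)),
    [/\ m = m' + w, (0 < w)%N, n = n' + w, row_free (row_mx P.1 a)
      & eqv (A, B) (ext P a)]%N.
Proof.
move=> nfA; have [w [R [R' [A' [iR RA fA']]]]] := col_mx_rank A.
have em := inverse_mx_dim iR.
have w0 : (0 < w)%N.
  rewrite lt0n; apply: contraNneq nfA => w0.
  by rewrite /row_free -{2}em w0 addn0.
case: (boolP (row_free (dsubmx (R *m B)))) => [fB | /not_row_freeP[v v0 vB]].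
  have [c [S [S' [iS BS]]]] := row_free_normalr fB; right.
  pose A1 := lsubmx (A' *m S); pose A2 := rsubmx (A' *m S).
  pose B1 := lsubmx (usubmx (R *m B) *m S).
  pose B2 := rsubmx (usubmx (R *m B) *m S).
  exists (\rank A), c, w, (A1, B1), A2; split=> //.
  - exact: inverse_mx_dim iS.
  - by rewrite hsubmxK (row_free_mul _ iS).
  apply: eqv_trans (eqv_mul _ _ iR iS) _.
  apply: eqv_trans (eqv_mul _ _ (inverse_mx_shear (- B2)) (inverse_mx1 F _)) _.
  have -> : R *m A *m S = block_mx A1 A2 0 0.
    by rewrite RA mul_col_mx mul0mx block_mxEv row_mx0 hsubmxK.
  have -> : R *m B *m S = block_mx B1 B2 0 1%:M.
    by rewrite -{1}[R *m B]vsubmxK mul_col_mx BS block_mxEv hsubmxK.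
  by rewrite !blockE addrN; apply: eqv_refl.
left; exists (row_mx 0 v *m R).
  apply: contraNneq v0 => vR; have : row_mx 0 v = 0 :> 'rV_(\rank A + w).
    by rewrite -[row_mx 0 v]mulmx1 -iR.1 mulmxA vR mul0mx.
  by rewrite -row_mx0 => /eq_row_mx[_ ->].
rewrite -!mulmxA RA mul_row_col mul0mx mulmx0 addr0; split=> //.
by rewrite -[R *m B]vsubmxK mul_row_col mul0mx add0r.
Qed.
End Reduction.

(** * Shifts, swaps and transposes of pairs *)

Section Operations.
Variable F : fieldType.

Definition shift_pair (lam : F) m n (P : mxpair F m n) : mxpair F m n :=
  (P.1 + lam *: P.2, P.2).
Definition swap_pair m n (P : mxpair F m n) : mxpair F m n := (P.2, P.1).
Definition tr_pair m n (P : mxpair F m n) : mxpair F n m := (P.1^T, P.2^T).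

Lemma eqv_shift lam m n m' n' (P : mxpair F m n) (Q : mxpair F m' n') :
  eqv P Q -> eqv (shift_pair lam P) (shift_pair lam Q).
Proof.
move=> [R [R' [S [S' [iR iS e1 e2]]]]]; exists R, R', S, S'; split=> //=.
by rewrite mulmxDr mulmxDl e1 -scalemxAr -scalemxAl e2.
Qed.

Lemma eqv_swap m n m' n' (P : mxpair F m n) (Q : mxpair F m' n') :
  eqv P Q -> eqv (swap_pair P) (swap_pair Q).
Proof. by move=> [R [R' [S [S' [iR iS e1 e2]]]]]; exists R, R', S, S'. Qed.

Lemma eqv_tr m n m' n' (P : mxpair F m n) (Q : mxpair F m' n') :
  eqv P Q -> eqv (tr_pair P) (tr_pair Q).
Proof.
move=> [R [R' [S [S' [iR iS e1 e2]]]]]; exists S^T, S'^T, R^T, R'^T.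
split; first exact: inverse_mx_tr.
- exact: inverse_mx_tr.
- by rewrite /= -e1 !trmx_mul mulmxA.
- by rewrite /= -e2 !trmx_mul mulmxA.
Qed.

Variables (T : Type) (r c : T -> nat) (P : forall x, mxpair F (r x) (c x)).

Lemma dsum_shift lam s :
  shift_pair lam (dsum P s) = dsum (fun x => shift_pair lam (P x)) s.
Proof.
elim: s => [|x s IHs] /=; first by rewrite /shift_pair scaler0 addr0.
by rewrite -IHs /dsum2 /shift_pair /= scale_block_mx add_block_mx !(scaler0, addr0).
Qed.

Lemma dsum_swap s : swap_pair (dsum P s) = dsum (fun x => swap_pair (P x)) s.
Proof. by elim: s => [|x s IHs] //=; rewrite -IHs. Qed.

Lemma dsum_tr s : tr_pair (dsum P s) = dsum (fun x => tr_pair (P x)) s.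
Proof.
elim: s => [|x s IHs] /=; first by rewrite /tr_pair !trmx0.
by rewrite -IHs /dsum2 /tr_pair /= !tr_block_mx !trmx0.
Qed.
End Operations.

(** * Jordan blocks and the columns that complete them *)

Section Jordan.
Variable F : fieldType.

Lemma jordan_block0 n :
  jordan_block n (0 : F) = \matrix_(i, j) (j == i.+1 :> nat)%:R.
Proof.
apply/matrixP=> i j; rewrite !mxE; case: eqP => // ->.
by rewrite ltn_eqF.
Qed.

Lemma jordan_blockD n (lam mu : F) :
  jordan_block n (lam + mu) = jordan_block n lam + mu%:M.
Proof.
by apply/matrixP=> i j; rewrite !mxE; case: eqP; rewrite ?mulr1n ?mulr0n ?addr0.
Qed.

Lemma jordan_block_row_free n (mu : F) : mu != 0 -> row_free (jordan_block n mu).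
Proof.
move=> mu0; rewrite row_free_unit unitmxE unitfE -det_tr det_trig.
  by apply/prodf_neq0 => i _; rewrite !mxE eqxx.
by apply/is_trig_mxP => i j ij; rewrite !mxE -val_eqE /= gtn_eqF // ltn_eqF // ltnW.
Qed.

(** The basis vector missing from the image of the nilpotent Jordan block, and from that of [F_n^T]
    when [n] counts one row more. *)
Definition last_col n : 'cV[F]_n := \col_i (i.+1 == n)%:R.

Lemma natr_delta_sum m (v : 'rV[F]_m) (j : 'I_m) (b : 'I_m -> bool) :
  (forall k, b k = (k == j)) -> \sum_k v 0 k * (b k)%:R = v 0 j.
Proof.
move=> bj; rewrite (bigD1 j) //= big1 => [|k /negPf kj]; rewrite bj ?kj ?mulr0 //.
by rewrite eqxx mulr1 addr0.
Qed.

Lemma ext_row_free m n (A : 'M[F]_(m.+1, n)) :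
  (forall j : 'I_m.+1, (j < m)%N ->
     exists j', forall k, A k j' = (k == j)%:R) ->
  row_free (row_mx A (last_col m.+1)).
Proof.
move=> hA; apply: inj_row_free => v; rewrite mul_mx_row -row_mx0.
move=> /eq_row_mx[vA va]; apply/rowP=> j; rewrite mxE.
case: (ltnP j m) => jm.
  have [j' Aj'] := hA _ jm; have := congr1 (fun M : 'rV_n => M 0 j') vA.
  rewrite !mxE => <-; rewrite -(natr_delta_sum v (j := j) (b := eq_op^~ j)) //.
  by apply: eq_bigr => k _; rewrite Aj'.
have := congr1 (fun M : 'rV_1 => M 0 0) va; rewrite !mxE => <-.
rewrite -(natr_delta_sum v (j := j) (b := fun k => k.+1 == m.+1)).
  by apply: eq_bigr => k _; rewrite mxE.
by move=> k; apply/idP/idP; rewrite -val_eqE /=; have := ltn_ord k;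
  have := ltn_ord j; lia.
Qed.

Lemma jordan0_ext_row_free n :
  row_free (row_mx (jordan_block n.+1 (0 : F)) (last_col n.+1)).
Proof.
apply: ext_row_free => j jn; exists (inord j.+1) => k.
by rewrite jordan_block0 mxE inordK // eqSS eq_sym.
Qed.

Lemma kroF_row_free n : row_free (kroF F n).
Proof.
apply: inj_row_free => v vF; apply/rowP=> j; rewrite mxE.
have := congr1 (fun M : 'rV_n.+1 => M 0 (lift ord_max j)) vF.
rewrite !mxE => <-.
rewrite -(natr_delta_sum v (j := j) (b := fun k => j == k)).
  by apply: eq_bigr => k _; rewrite mxE lift_max.
by move=> k; rewrite eq_sym.
Qed.

Lemma kroF_tr_ext_row_free n : row_free (row_mx (kroF F n)^T (last_col n.+1)).
Proof.
apply: ext_row_free => j jn; exists (Ordinal jn) => k.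
by rewrite !mxE.
Qed.

Lemma ext_entries m n m' n' (P : mxpair F m n) (Q : mxpair F m' n') (a : 'cV_m) :
  m' = m.+1 -> n' = n.+1 ->
  (forall (i' : 'I_m') (j' : 'I_n'),
     (forall (i : 'I_m) (j : 'I_n), i' = i :> nat -> j' = j :> nat ->
        P.1 i j = Q.1 i' j' /\ P.2 i j = Q.2 i' j') /\
     [/\ forall i : 'I_m, i' = i :> nat -> j' = n :> nat ->
        a i 0 = Q.1 i' j' /\ 0 = Q.2 i' j',
     forall j : 'I_n, i' = m :> nat -> j' = j :> nat ->
        0 = Q.1 i' j' /\ 0 = Q.2 i' j'
     & i' = m :> nat -> j' = n :> nat -> 0 = Q.1 i' j' /\ 1 = Q.2 i' j']) ->
  eqv (ext P a) Q.
Proof.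
move=> em en h; apply: eqv_entries; rewrite ?addn1 // => i j i' j' ei ej.
rewrite /= !mxE; have [h1 [h2 h3 h4]] := h i' j'.
case: splitP => k ek; rewrite !mxE; case: splitP => l el; rewrite ?ord1 ?mxE; last 2 first.
- by apply: h3; [rewrite -ei ek ord1 addn0 | rewrite -ej el].
- by apply: h4; rewrite -(ei, ej) (ek, el) ord1 addn0.
- by apply: h1; rewrite -(ei, ej).
- by apply: h2; [rewrite -ei ek | rewrite -ej el ord1 addn0].
Qed.

End Jordan.

(** * Existence of the Jordan and Kronecker forms *)

Section Kronecker.
Variable F : fieldType.

Lemma ext_jordan n :
  eqv (ext ((jordan_block n.+1 0, 1%:M) : mxpair F _ _) (last_col F n.+1))
      ((jordan_block n.+2 0, 1%:M) : mxpair F _ _).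
Proof.
apply: ext_entries => // i' j'; rewrite /= !jordan_block0 !mxE -!val_eqE /=.
split=> [i j ei ej|].
  by rewrite !mxE -!val_eqE /= ei ej.
split=> [i ei ej|j ei ej|ei ej]; rewrite ?mxE ei ej ?eqxx.
- by rewrite eq_sym (ltn_eqF (ltn_ord i)).
- by rewrite (ltn_eqF (leqW (ltn_ord j))) (gtn_eqF (ltn_ord j)).
- by rewrite ltn_eqF.
Qed.

Lemma ext_kroF_tr n :
  eqv (ext (tr_pair (kroF F n, kroG F n)) (last_col F n.+1))
      (tr_pair (kroF F n.+1, kroG F n.+1)).
Proof.
apply: ext_entries => // i' j'; rewrite /= !mxE /=.
split=> [i j ei ej|]; first by rewrite !mxE ei ej.
split=> [i ei ej|j ei ej|ei ej]; rewrite ?mxE ei ej ?eqxx ?eqSS.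
- by rewrite (ltn_eqF (ltn_ord i)).
- by rewrite (gtn_eqF (leqW (ltn_ord j))) (gtn_eqF (ltn_ord j)).
- by rewrite gtn_eqF.
Qed.

Lemma nilpotent1_jordan :
  eqv ((0, 1%:M) : mxpair F 1 1) ((jordan_block 1 0, 1%:M) : mxpair F 1 1).
Proof.
apply: eqv_entries => // i j i' j' _ _ /=.
by rewrite !ord1 !mxE.
Qed.

(** The identity comes second, opposite to [KroJ], because [ext] has its identity block in the
    second component. *)
Definition jordan_pair (x : nat * F) : mxpair F x.1.+1 x.1.+1 :=
  (jordan_block x.1.+1 x.2, 1%:M).

Lemma ext_jordan_dsum s w (a : 'M[F]_(_, w)) :
  row_free (row_mx (dsum jordan_pair s).1 a) ->
  exists s', eqv (ext (dsum jordan_pair s) a) (dsum jordan_pair s').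
Proof.
apply: (ext_dsum (x0 := (0%N, 0))); first exact: nilpotent1_jordan.
move=> [n lam] /= nf.
have -> : lam = 0 by apply: contraNeq nf; apply: jordan_block_row_free.
exists (last_col F n.+1), (n.+1, 0); split; first exact: jordan0_ext_row_free.
exact: ext_jordan.
Qed.

Lemma ext_kro_dsum s w (a : 'M[F]_(_, w)) :
  row_free (row_mx (dsum (@kro_pair F) s).1 a) ->
  exists s', eqv (ext (dsum (@kro_pair F) s) a) (dsum (@kro_pair F) s').
Proof.
apply: (ext_dsum (x0 := KroJinf 0)); first exact: nilpotent1_jordan.
move=> [n lam|n|n|n] /= nf.
- by rewrite row_free_unit unitmx1 in nf.
- exists (last_col F n.+1), (KroJinf n.+1); split.
    exact: jordan0_ext_row_free.
  exact: ext_jordan.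
- by rewrite kroF_row_free in nf.
- exists (last_col F n.+1), (KroFGT n.+1); split.
    exact: kroF_tr_ext_row_free.
  exact: ext_kroF_tr.
Qed.
End Kronecker.

Section KroneckerClosed.
Variable F : closedFieldType.

Lemma exists_eigenvector n (M : 'M[F]_n.+1) :
  exists lam (v : 'rV_n.+1), v != 0 /\ v *m M = lam *: v.
Proof.
have [lam] : exists lam, root (char_poly M) lam.
  by apply/closed_rootP; rewrite size_char_poly.
by rewrite -eigenvalue_root_char => /eigenvalueP[v vM v0]; exists lam, v.
Qed.

(** Subtracting an eigenvalue makes [M] singular, so [(N, 1)] reduces to a smaller [(A1, B1)]. There
    [B1] is invertible because [diag(B1, I)] is equivalent to the identity, so the induction applies
    to [B1^-1 A1]; the result is extended back and the eigenvalue is added again. *)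
Lemma jordan_form n (M : 'M[F]_n) :
  exists s, eqv ((M, 1%:M) : mxpair F n n) (dsum (@jordan_pair F) s).
Proof.
elim/ltn_ind: n M => -[|n] IHn M.
  by exists [::]; apply: eqv_entries => // -[].
have [lam [v [v0 vM]]] := exists_eigenvector M.
pose N := M - lam%:M.
have nfN : ~~ row_free N.
  apply: contraNN v0 => fN; apply/eqP/(row_free_kernel fN).
  by rewrite mulmxBr vM mul_mx_scalar subrr.
have [s es] : exists s, eqv ((N, 1%:M) : mxpair F _ _) (dsum (@jordan_pair F) s).
  (* A zero row cannot split off, since the second component is the identity. *)
  have [[u u0 [_]]|[m [n' [w [[A1 B1] [a [em w0 en fA eE]]]]]]] :=
    not_row_free_ext 1%:M nfN; first by rewrite mulmx1 => u1; rewrite u1 eqxx in u0.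
  have {en} en : n' = m by apply/eqP; rewrite -(eqn_add2r w) -en em.
  subst n'; rewrite /= in fA.
  have uB : B1 \in unitmx.
    case: eE => R [R' [S [S' [iR iS _ /= eB]]]].
    rewrite -row_free_unit; apply: inj_row_free => y yB.
    have fb : row_free (block_mx B1 0 0 1%:M : 'M_(m + w)).
      rewrite -eB (row_free_mul _ iS) (row_free_mull _ iR).
      by rewrite row_free_unit unitmx1.
    have := row_free_kernel fb (v := row_mx y 0).
    rewrite mul_row_block yB !blockE row_mx0 => /(_ erefl).
    by rewrite -row_mx0 => /eq_row_mx[].
  have [|s es] := IHn m _ (invmx B1 *m A1); first by rewrite em -addn1 leq_add2l.
  have eP : eqv ((A1, B1) : mxpair F m m) (dsum (@jordan_pair F) s).
    apply: eqv_trans es; exists (invmx B1), B1, 1%:M, 1%:M; split.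
    - exact/inverse_mx_sym/inverse_mx_unit.
    - exact: inverse_mx1.
    - by rewrite mulmx1.
    - by rewrite mulmx1 mulVmx.
  have [b [eb fb]] := ext_eqv eP fA.
  have [s' es'] := ext_jordan_dsum fb.
  by exists s'; apply: eqv_trans eE (eqv_trans eb es').
exists [seq (x.1, x.2 + lam) | x <- s].
have := eqv_shift lam es; rewrite dsum_shift {1}/shift_pair /= scalemx1 subrK.
move=> eM; apply: eqv_trans eM (dsum_map _ _) => x.
rewrite /shift_pair /jordan_pair /= scalemx1 -jordan_blockD; exact: eqv_refl.
Qed.

End KroneckerClosed.

(** * Reordering of bases, transposed blocks and the path pair *)

Section Reindex.
Variable F : fieldType.

Lemma eqv_reindex m n m' n' (P : mxpair F m n) (Q : mxpair F m' n')
    (f : 'I_m' -> 'I_m) f' (g : 'I_n' -> 'I_n) g' :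
  cancel f f' -> cancel f' f -> cancel g g' -> cancel g' g ->
  (forall i j, P.1 (f i) (g j) = Q.1 i j /\ P.2 (f i) (g j) = Q.2 i j) ->
  eqv P Q.
Proof.
move=> fK f'K gK g'K h.
have r p q (u : 'I_p -> 'I_q) v : cancel u v ->
    rowsub u (1%:M : 'M[F]_q) *m rowsub v 1%:M = 1%:M.
  move=> uK; rewrite mul_rowsub_mx mul1mx.
  by apply/matrixP=> i j; rewrite !mxE uK.
have s p q (u : 'I_p -> 'I_q) v : cancel u v ->
    colsub v (1%:M : 'M[F]_p) *m colsub u 1%:M = 1%:M.
  move=> uK; rewrite mulmx_colsub mulmx1.
  by apply/matrixP=> i j; rewrite !mxE uK.
exists (rowsub f 1%:M), (rowsub f' 1%:M), (colsub g 1%:M), (colsub g' 1%:M).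
split; try by split; [apply: r || apply: s..].
all: rewrite mulmx_colsub mulmx1 mul_rowsub_mx mul1mx.
all: by apply/matrixP=> i j; rewrite !mxE; case: (h i j).
Qed.

(** Reversing the order of the basis transposes a Jordan block. *)
Lemma eqv_jordan_tr n (lam : F) :
  eqv (tr_pair (1%:M, jordan_block n lam))
      ((1%:M, jordan_block n lam) : mxpair F n n).
Proof.
apply: (eqv_reindex (f := @rev_ord n) (f' := @rev_ord n)
  (g := @rev_ord n) (g' := @rev_ord n)); try exact: rev_ordK.
move=> i j; rewrite /= !mxE !(inj_eq rev_ord_inj) [j == i]eq_sym.
split=> //; case: eqP => // _; congr (_%:R).
have := ltn_ord i; have := ltn_ord j; rewrite /=; lia.
Qed.

Lemma dsum1 T (r c : T -> nat) (P : forall x, mxpair F (r x) (c x)) x :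
  eqv (dsum P [:: x]) (P x).
Proof.
apply: eqv_entries; rewrite /= ?addn0 // => i j i' j' ei ej /=.
have -> : i = lshift 0 i' by apply: val_inj.
have -> : j = lshift 0 j' by apply: val_inj.
by rewrite !block_mxEul.
Qed.

(** Nonzero entries join indices of opposite parity. With 0-based indices, odd rows and even columns
    carry [(F_k, G_k)], even rows and odd columns its transpose; [f] and [g] list the indices in
    this order. *)
Lemma path_pair_kro k :
  eqv (path_pair F k) (dsum (@kro_pair F) [:: KroFG k; KroFGT k]).
Proof.
suff : eqv (path_pair F k)
    (dsum2 (kro_pair (KroFG k)) (kro_pair (KroFGT k))).
  move=> h; apply: eqv_trans h _.
  exact/eqv_dsum2/eqv_sym/dsum1/eqv_refl.
have hf (i : 'I_(k + k.+1)) :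
    ((if i < k then i.*2.+1 else (i - k).*2) < k.*2.+1)%N.
  by have := ltn_ord i; case: ifP; lia.
have hf' (i : 'I_(k.*2.+1)) :
    ((if odd i then i./2 else k + i./2) < k + k.+1)%N.
  by have := ltn_ord i; case: ifP; lia.
have hg (i : 'I_(k.+1 + k)) :
    ((if i < k.+1 then i.*2 else (i - k.+1).*2.+1) < k.*2.+1)%N.
  by have := ltn_ord i; case: ifP; lia.
have hg' (i : 'I_(k.*2.+1)) :
    ((if odd i then k.+1 + i./2 else i./2) < k.+1 + k)%N.
  by have := ltn_ord i; case: ifP; lia.
apply: (eqv_reindex
  (f := fun i => Ordinal (hf i)) (f' := fun i => Ordinal (hf' i))
  (g := fun i => Ordinal (hg i)) (g' := fun i => Ordinal (hg' i))).
- by move=> i; apply: val_inj => /=; have := ltn_ord i; do !case: ifP; lia.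
- by move=> i; apply: val_inj => /=; have := ltn_ord i; do !case: ifP; lia.
- by move=> i; apply: val_inj => /=; have := ltn_ord i; do !case: ifP; lia.
- by move=> i; apply: val_inj => /=; have := ltn_ord i; do !case: ifP; lia.
move=> i j; rewrite /= !mxE /=; have := ltn_ord i; have := ltn_ord j.
(* The zeros outside the diagonal blocks are written [false%:R], so that every case compares
   booleans and is decided by index arithmetic. *)
case: (splitP i) => i' ei; rewrite !mxE; case: (splitP j) => j' ej; rewrite !mxE;
  have := ltn_ord i'; have := ltn_ord j'; do ?case: ifP;
  rewrite -?[0]/(false%:R : F).
all: split; congr (_%:R); lia.
Qed.
End Reindex.

Definition tr_kro (F : Type) (x : kro_summand F) : kro_summand F :=
  match x with
  | KroFG n => KroFGT n
  | KroFGT n => KroFG n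
  | y => y
  end.

Lemma dsum_tr_kro (F : fieldType) m n (P : mxpair F m n) c :
  eqv P (dsum (@kro_pair F) c) ->
  eqv (tr_pair P) (dsum (@kro_pair F) (map (@tr_kro F) c)).
Proof.
move=> /eqv_tr; rewrite dsum_tr => ePc; apply: eqv_trans ePc (dsum_map _ _).
case=> [k lam|k|k|k] /=; rewrite /tr_pair /= ?trmx1 ?trmxK.
- by rewrite -[1%:M in X in eqv X _]trmx1; apply: eqv_jordan_tr.
- rewrite -[1%:M in X in eqv X _]trmx1.
  exact: (eqv_swap (eqv_jordan_tr k.+1 (0 : F))).
- exact: eqv_refl.
- exact: eqv_refl.
Qed.

(** * Existence of the Kronecker form *)

Section KroneckerForm.
Variable F : closedFieldType.
Notation kro_dsum := (dsum (@kro_pair F)).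

(** Both alternatives of [not_row_free_ext] leave a smaller pair, whose decomposition gains a zero
    row or is extended by [ext_kro_dsum]. *)
Lemma kronecker_step m n (A B : 'M[F]_(m, n)) :
  ~~ row_free A ->
  (forall m' n' (P : mxpair F m' n'), (m' + n' < m + n)%N ->
     exists c, eqv P (kro_dsum c)) ->
  exists c, eqv ((A, B) : mxpair F m n) (kro_dsum c).
Proof.
move=> nfA IH.
have [[v v0 [vA vB]]|[m' [n' [w [P [a [em w0 en fa eE]]]]]]] :=
  not_row_free_ext B nfA.
  have [m' [Q [em eQ]]] := split_zero_row v0 vA vB.
  have [|c ec] := IH _ _ Q; first by rewrite em.
  (* The zero row is the pair [(F_0^T, G_0^T)]. *)
  exists (KroFGT 0 :: c); apply: eqv_trans eQ (eqv_dsum2 _ ec).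
  by apply: eqv_entries => // i [].
have [|c ec] := IH _ _ P; first by lia.
have [b [eb fb]] := ext_eqv ec fa.
have [c' ec'] := ext_kro_dsum fb.
by exists c'; apply: eqv_trans eE (eqv_trans eb ec').
Qed.

Lemma kronecker_form m n (P : mxpair F m n) : exists c, eqv P (kro_dsum c).
Proof.
have [N] := ubnP (m + n)%N; elim: N m n P => // N IHN m n [A B] ltN.
case: (boolP (row_free A)) => [fA|nfA]; last first.
  by apply: kronecker_step => // m' n' P ltP; apply: IHN; lia.
case: (boolP (row_free A^T)) => [fA'|nfA']; last first.
  have [|c ec] := kronecker_step B^T nfA'.
    by move=> m' n' P ltP; apply: IHN; lia.
  exists (map (@tr_kro F) c); have := dsum_tr_kro ec.
  by rewrite /tr_pair /= !trmxK.
(* [A] and its transpose have full row rank, so [A] is square and invertible, and [(A, B)] is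
   equivalent to [(1, A^-1 B)]. *)
have emn : m = n.
  apply/eqP; rewrite eqn_leq -{1}(eqP fA) rank_leq_col -(eqP fA').
  by rewrite mxrank_tr rank_leq_row.
subst n; rewrite row_free_unit in fA.
have [s es] := jordan_form (invmx A *m B).
exists [seq KroJ x.1 x.2 | x <- s].
have eA : eqv (A, B) (swap_pair (invmx A *m B, 1%:M)).
  exists (invmx A), A, 1%:M, 1%:M; rewrite /= !mulmx1 mulVmx //; split=> //.
    exact/inverse_mx_sym/inverse_mx_unit.
  exact: inverse_mx1.
have := eqv_swap es; rewrite dsum_swap => es'.
apply: eqv_trans eA (eqv_trans es' (dsum_map _ _)) => -[k lam].
exact: eqv_refl.
Qed.
End KroneckerForm.

(** * Equivalent symmetric pairs are congruent *)

Lemma symmetricmxE (F : fieldType) n (A : 'M[F]_n) :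
  (A \is symmetricmx) = (A^T == A).
Proof. by rewrite is_hermitianmxE expr0 scale1r map_mx_id // eq_sym. Qed.

Section SquareRoot.
Variables (F : closedFieldType).
Hypothesis charF : (2 \notin [pchar F])%N.

Lemma two_neq0 : 2%:R != 0 :> F.
Proof. by move: charF; rewrite inE /=. Qed.

Lemma closed_sqrt (a : F) : exists s, s ^+ 2 = a.
Proof.
(* The coefficients [a, 0] encode the equation [x ^+ 2 = a + 0 * x]. *)
have [s es] := @GRing.solve_monicpoly F 2 (nth 0 [:: a]) isT.
by exists s; rewrite es !big_ord_recl big_ord0 /= mulr1 mul0r !addr0.
Qed.

(* A square root of ['X] modulo [q] is corrected by a multiple [c *: q] of [q]
   so as to become one modulo [q * ('X - a%:P)]; [c] solves a quadratic equation
   if [q.[a] != 0] and a linear one (Hensel lifting) if [q.[a] = 0]. *)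
Lemma sqrtX_modulo (rs : seq F) : 0 \notin rs ->
  exists p : {poly F}, \prod_(a <- rs) ('X - a%:P) %| p ^+ 2 - 'X.
Proof.
elim: rs => [|a rs IHrs]; first by exists 0; rewrite big_nil dvd1p.
rewrite inE negb_or eq_sym => /andP[a0 /IHrs[p]]; rewrite big_cons.
set q := \prod_(_ <- _) _ => /dvdpP[u epu].
have epa : p.[a] ^+ 2 - a = u.[a] * q.[a].
  by rewrite -hornerM -epu !hornerE.
have [c ec] : exists c, u.[a] + c * (2%:R * p.[a]) + c ^+ 2 * q.[a] = 0.
  have [qa|qa] := eqVneq q.[a] 0.
    have pa : p.[a] != 0.
      apply: contraNneq a0 => pa; move: epa.
      by rewrite pa qa mulr0 expr0n sub0r => /eqP; rewrite oppr_eq0.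
    exists (- u.[a] / (2%:R * p.[a])); rewrite qa mulr0 addr0 divfK ?addrN //.
    by rewrite mulf_neq0 // two_neq0.
  have [s es] := closed_sqrt a; exists ((s - p.[a]) / q.[a]).
  apply: (mulIf qa); rewrite mul0r !mulrDl.
  rewrite -epa -[0](subrr a) -{2}es; field; exact: qa.
exists (p + c *: q); have : root (u + c *: (2%:R *: p) + c ^+ 2 *: q) a.
  by rewrite /root !(hornerD, hornerZ) ec.
move=> /factor_theorem[v ev]; apply/dvdpP; exists v.
have ep : p ^+ 2 = u * q + 'X by rewrite -epu subrK.
rewrite mulrA -ev sqrrD ep -!mul_polyC polyC_exp; ring.
Qed.

(** [K] is the value at [M] of a square root of ['X] modulo the characteristic polynomial, which
    kills [M] by Cayley-Hamilton and does not vanish at 0. The relation with [A] passes from [M] to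
    every polynomial in [M]. *)
Lemma mx_sqrt n (M : 'M[F]_n) : M \in unitmx ->
  exists2 K : 'M_n, K *m K = M &
    forall A : 'M_n, M *m A = A *m M^T -> K *m A = A *m K^T.
Proof.
case: n M => [|n] M uM.
  by exists 0 => [|A _]; apply/matrixP => -[].
have [rs ers] := closed_field_poly_normal (char_poly M).
rewrite (monicP (char_poly_monic M)) scale1r in ers.
have rs0 : 0 \notin rs.
  rewrite -root_prod_XsubC -ers rootE horner_coef0 char_poly_det.
  by rewrite mulf_eq0 signr_eq0 /= -unitfE -unitmxE.
have [p] := sqrtX_modulo rs0; rewrite -ers => /dvdpP[u eu].
exists (horner_mx M p) => [|A MA].
  have := congr1 (horner_mx M) eu.
  rewrite rmorphB rmorphXn rmorphM /= Cayley_Hamilton mulr0 horner_mx_X.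
  by move/eqP; rewrite subr_eq0 => /eqP.
elim/poly_ind: p {eu} => [|p c IHp].
  by rewrite rmorph0 trmx0 mul0mx mulmx0.
rewrite rmorphD rmorphM /= horner_mx_X horner_mx_C.
rewrite mulmxDl -mulmxA MA mulmxA IHp -mulmxA linearD /= trmx_mul.
rewrite tr_scalar_mx mulmxDr scalar_mxC; congr (_ *m _ + _).
have /(congr1 trmx) : horner_mx M (p * 'X) = horner_mx M ('X * p) by rewrite mulrC.
by rewrite !rmorphM /= horner_mx_X !trmx_mul => ->.
Qed.

Lemma eqv_congruent n n' (A B : 'M[F]_n) (A' B' : 'M[F]_n') :
  A \is symmetricmx -> B \is symmetricmx ->
  A' \is symmetricmx -> B' \is symmetricmx ->
  eqv (A, B) (A', B') -> congruent (A, B) (A', B').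
Proof.
rewrite !symmetricmxE => /eqP sA /eqP sB /eqP sA' /eqP sB'.
case/equivalentP=> en [en' [R [S [uR uS]]]].
subst n'; rewrite (eq_axiomK en') !castmx_id /= => eA eB.
pose M := invmx S^T *m R.
have uM : M \in unitmx by rewrite unitmx_mul unitmx_inv unitmx_tr uS.
have [K KK Kcomm] := mx_sqrt uM.
(* Symmetry of [X'] reads [R X S = S^T X R^T]; multiply by [S^-T] on the left and [S^-1] on the
   right. *)
have MX X X' : X^T = X -> X'^T = X' -> R *m X *m S = X' -> M *m X = X *m M^T.
  move=> sX sX' eX; have uST : S^T \in unitmx by rewrite unitmx_tr.
  apply: (can_inj (mulKmx uST)); apply: (can_inj (mulmxK uS)).
  rewrite !mulmxA mulmxV // mul1mx eX -sX' -eX !trmx_mul sX.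
  by rewrite trmx_inv trmxK !mulmxA mulmxKV.
exists erefl, (K^T *m S); rewrite castmx_id; split.
- rewrite unitmx_mul unitmx_tr uS andbT.
  by move: uM; rewrite -KK unitmx_mul => /andP[].
(* [S^T K A K^T S = S^T K K A S = S^T M A S = R A S]. *)
- rewrite trmx_mul trmxK -!mulmxA (mulmxA A) -Kcomm ?(MX _ A') // !mulmxA.
  by rewrite -(mulmxA _ K K) KK /M !mulmxA mulmxV ?unitmx_tr // mul1mx.
- rewrite trmx_mul trmxK -!mulmxA (mulmxA B) -Kcomm ?(MX _ B') // !mulmxA.
  by rewrite -(mulmxA _ K K) KK /M !mulmxA mulmxV ?unitmx_tr // mul1mx.
Qed.
End SquareRoot.

(** * Uniqueness of the Kronecker form *)

Section HomDimension.
Variable F : fieldType.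

Definition intertwines m n p q (P : mxpair F m n) (Q : mxpair F p q) V : Prop :=
  P.1 *m V *m Q.1 = P.2 *m V *m Q.2.

(** The dimension is witnessed by a linear injective parametrization of the solutions by row
    vectors, which can be written down explicitly for each pair of blocks. *)
Definition hom_dim m n p q (P : mxpair F m n) (Q : mxpair F p q) d : Prop :=
  exists phi : 'rV[F]_d -> 'M[F]_(n, p),
    [/\ linear phi, forall u, phi u = 0 -> u = 0
      & forall V, intertwines P Q V <-> exists u, V = phi u].

Lemma linear_comb (U W : lmodType F) (f : U -> W) I (r : seq I)
    (c : I -> F) (w : I -> U) : linear f ->
  f (\sum_(i <- r) c i *: w i) = \sum_(i <- r) c i *: f (w i).
Proof.
move=> lf; pose Lf := GRing.isLinear.Build _ _ _ _ f lf.
pose f' : {linear U -> W} := HB.pack f Lf.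
rewrite [LHS](linear_sum f'); by apply: eq_bigr => i _; rewrite (linearZZ f').
Qed.

(** The first parametrization factors through the second by a [d x d'] matrix, whose rows are
    independent by injectivity. *)
Lemma hom_dim_leq m n p q (P : mxpair F m n) (Q : mxpair F p q) d d' :
  hom_dim P Q d -> hom_dim P Q d' -> (d <= d')%N.
Proof.
move=> [f [lf f0 Pf]] [g [lg g0 Pg]].
have fg u : exists w, f u = g w by apply/Pg/Pf; exists u.
have /fin_all_exists[w ew] (i : 'I_d) := fg (delta_mx 0 i).
pose K := \matrix_i w i.
have efg u : f u = g (u *m K).
  have -> : u *m K = \sum_i u 0 i *: w i.
    by rewrite mulmx_sum_row; apply: eq_bigr => i _; rewrite rowK.
  rewrite {1}[u]row_sum_delta !linear_comb //.
  by apply: eq_bigr => i _; rewrite ew.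
rewrite -(_ : \rank K = d) ?rank_leq_col //.
apply/eqP; rewrite -/(row_free K).
apply: inj_row_free => u uK; apply: f0; rewrite efg uK.
by have := lg (-1) 0 0; rewrite scaler0 addr0 scaleN1r addNr.
Qed.

Lemma hom_dim_uniq m n p q (P : mxpair F m n) (Q : mxpair F p q) d d' :
  hom_dim P Q d -> hom_dim P Q d' -> d = d'.
Proof.
by move=> h h'; apply/eqP; rewrite eqn_leq !(hom_dim_leq h h', hom_dim_leq h' h).
Qed.

(** [V |-> S^-1 V] carries the solutions for [P] to those for [P']. *)
Lemma hom_dim_eqv m n m' n' p q (P : mxpair F m n) (P' : mxpair F m' n')
    (Q : mxpair F p q) d :
  eqv P P' -> hom_dim P Q d -> hom_dim P' Q d.
Proof.
move=> [R [R' [S [S' [iR iS e1 e2]]]]] [f [lf f0 Pf]].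
exists (fun u => S' *m f u); split.
- by move=> a u v; rewrite lf mulmxDr scalemxAr.
- move=> u Su; apply: f0; rewrite -[f u]mul1mx -iS.1 -mulmxA Su mulmx0 //.
have PV V : intertwines P' Q V <-> intertwines P Q (S *m V).
  rewrite /intertwines -e1 -e2 -!mulmxA; split=> [|->//].
  by move/(congr1 (mulmx R')); rewrite !mulmxA iR.2 !mul1mx.
move=> V; rewrite PV Pf; split=> -[u eV]; exists u.
  by rewrite -eV mulmxA iS.2 mul1mx.
by rewrite eV mulmxA iS.1 mul1mx.
Qed.

Lemma hom_dim_dsum2 m n m' n' p q (P : mxpair F m n) (P' : mxpair F m' n')
    (Q : mxpair F p q) d d' :
  hom_dim P Q d -> hom_dim P' Q d' -> hom_dim (dsum2 P P') Q (d + d').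
Proof.
move=> [f [lf f0 Pf]] [g [lg g0 Pg]].
exists (fun u => col_mx (f (lsubmx u)) (g (rsubmx u))); split.
- move=> a u v; rewrite !linearP lf lg scale_col_mx add_col_mx.
  by [].
- move=> u; rewrite -col_mx0 => /eq_col_mx[/f0 u1 /g0 u2].
  by rewrite -[u]hsubmxK u1 u2 row_mx0.
move=> V; rewrite -[V]vsubmxK /intertwines /= !mul_block_col.
rewrite !(mul0mx, addr0, add0r) !mul_col_mx; split.
  move=> /eq_col_mx[/Pf[u ->] /Pg[v ->]]; exists (row_mx u v).
  by rewrite row_mxKl row_mxKr.
move=> [u] /eq_col_mx[uV dV]; congr col_mx.
  by apply/Pf; exists (lsubmx u).
by apply/Pg; exists (rsubmx u).
Qed.

Lemma hom_dim_dsum T (r c : T -> nat) (P : forall x, mxpair F (r x) (c x))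
    p q (Q : mxpair F p q) (d : T -> nat) s :
  (forall x, hom_dim (P x) Q (d x)) -> hom_dim (dsum P s) Q (sumn (map d s)).
Proof.
move=> hd; elim: s => [|x s IHs] /=; last exact: hom_dim_dsum2.
exists (fun _ => 0); split.
- by move=> a u v; rewrite scaler0 addr0.
- by move=> u _; apply/rowP=> -[].
- by move=> V; split=> _; [exists 0 |]; apply/matrixP=> -[].
Qed.

Lemma hom_dim0 m n p q (P : mxpair F m n) (Q : mxpair F p q) :
  (forall V, intertwines P Q V -> V = 0) -> hom_dim P Q 0.
Proof.
move=> h; exists (fun _ => 0); split.
- by move=> a u v; rewrite scaler0 addr0.
- by move=> u _; apply/rowP=> -[].
- move=> V; split=> [/h ->|[_ ->]]; first by exists 0.
  by rewrite /intertwines !mulmx0 !mul0mx.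
Qed.
End HomDimension.

(** * Entries extended by zero *)

Section Entries.
Variable F : fieldType.

(* Extending the entries by zero to all indices turns products with Jordan
   blocks and with F_n, G_n into index shifts without boundary cases. *)
Definition entry m n (V : 'M[F]_(m, n)) (i j : nat) : F :=
  if insub i is Some i' then if insub j is Some j' then V i' j' else 0 else 0.

Definition delay (f : nat -> F) (j : nat) : F := if j is j'.+1 then f j' else 0.

Variables (m n : nat).
Implicit Types V : 'M[F]_(m, n).

Lemma entryE V (i : 'I_m) (j : 'I_n) : V i j = entry V i j.
Proof. by rewrite /entry !valK. Qed.

Lemma entry_row0 V i j : (m <= i)%N -> entry V i j = 0.
Proof. by move=> mi; rewrite /entry insubF // ltnNge mi. Qed.

Lemma entry_col0 V i j : (n <= j)%N -> entry V i j = 0.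
Proof.
by move=> nj; rewrite /entry [insub j]insubF ?ltnNge ?nj //; case: insub.
Qed.

Lemma entryP V W :
  (forall i j, (i < m)%N -> (j < n)%N -> entry V i j = entry W i j) -> V = W.
Proof. by move=> h; apply/matrixP=> i j; rewrite !entryE h. Qed.

Lemma entry0 i j : entry (0 : 'M[F]_(m, n)) i j = 0.
Proof. by rewrite /entry; do 2?case: insub => // ?; rewrite mxE. Qed.

Lemma sum_delta_row V (i : nat) (j : 'I_n) :
  \sum_(k < m) (k == i :> nat)%:R * V k j = entry V i j.
Proof.
case: (ltnP i m) => im.
  rewrite (bigD1 (Ordinal im)) //= eqxx mul1r big1 ?addr0.
    by rewrite (entryE V (Ordinal im)).
  by move=> k /negPf; rewrite -val_eqE /= => ->; rewrite mul0r.
rewrite entry_row0 // big1 // => k _.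
by rewrite ltn_eqF ?mul0r // (leq_trans (ltn_ord k)).
Qed.

Lemma sum_delta_col V (i : 'I_m) (j : nat) :
  \sum_(k < n) V i k * (k == j :> nat)%:R = entry V i j.
Proof.
case: (ltnP j n) => jn.
  rewrite (bigD1 (Ordinal jn)) //= eqxx mulr1 big1 ?addr0.
    by rewrite (entryE V _ (Ordinal jn)).
  by move=> k /negPf; rewrite -val_eqE /= => ->; rewrite mulr0.
rewrite entry_col0 // big1 // => k _.
by rewrite ltn_eqF ?mulr0 // (leq_trans (ltn_ord k)).
Qed.
End Entries.

Section EntryProducts.
Variable F : fieldType.

Lemma entry_mulP m n p (A : 'M[F]_(m, n)) (B : 'M[F]_(n, p)) (f : nat -> nat -> F) :
  (forall i j, (m <= i)%N || (p <= j)%N -> f i j = 0) ->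
  (forall (i : 'I_m) (j : 'I_p), \sum_k A i k * B k j = f i j) ->
  forall i j, entry (A *m B) i j = f i j.
Proof.
move=> f0 fE i j; case: (ltnP i m) => im; last by rewrite entry_row0 ?f0 ?im.
case: (ltnP j p) => jp; last by rewrite entry_col0 ?f0 ?jp ?orbT.
rewrite -(fE (Ordinal im) (Ordinal jp)).
by rewrite -(entryE _ (Ordinal im) (Ordinal jp)) mxE.
Qed.

Variables (m n : nat).
Implicit Types (V : 'M[F]_(m, n)).

Lemma entry_jordanl lam V i j :
  entry (jordan_block m lam *m V) i j = lam * entry V i j + entry V i.+1 j.
Proof.
move: i j; apply: entry_mulP => [i j /orP[mi|nj]|i j].
- by rewrite !entry_row0 ?mulr0 ?addr0 // ltnW.
- by rewrite !entry_col0 ?mulr0 ?addr0.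
rewrite -!sum_delta_row mulr_sumr -big_split /=; apply: eq_bigr => k _.
rewrite !mxE eq_sym -val_eqE /=; case: eqP => [->|_].
  by rewrite mul1r ltn_eqF // mul0r addr0.
by rewrite mul0r mulr0 add0r.
Qed.

(** The bound on [j] excludes [j = n], where the left side is 0 but [delay] returns the last entry
    of the row. *)
Lemma entry_jordanr lam V i j : (j < n)%N ->
  entry (V *m jordan_block n lam) i j = lam * entry V i j + delay (entry V i) j.
Proof.
move=> jn; case: (ltnP i m) => im; last first.
  by rewrite !entry_row0 // mulr0 add0r; case: j {jn} => //= j; rewrite entry_row0.
rewrite -(entryE _ (Ordinal im) (Ordinal jn)) mxE.
rewrite -(sum_delta_col V (Ordinal im) j) mulr_sumr.
have -> : delay (entry V i) j =
    \sum_(k < n) V (Ordinal im) k * (j == k.+1 :> nat)%:R.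
  case: j jn => [|j] jn /=; first by rewrite big1 // => k _; rewrite mulr0.
  rewrite -(sum_delta_col V (Ordinal im) j); apply: eq_bigr => k _.
  by rewrite eqSS eq_sym.
rewrite -big_split; apply: eq_bigr => k _; rewrite mxE -val_eqE /=.
case: eqP => [->|_]; last by rewrite !mulr0 add0r.
by rewrite mulr1 ltn_eqF // mulr0 addr0 mulrC.
Qed.

Lemma entry_kroFr V i j : entry (V *m kroF F n) i j = entry V i j.
Proof.
move: i j; apply: entry_mulP => [i j /orP[mi|nj]|i j].
- by rewrite entry_row0.
- by rewrite entry_col0 // ltnW.
by rewrite -sum_delta_col; apply: eq_bigr => k _; rewrite mxE eq_sym.
Qed.

Lemma entry_kroGr V i j : entry (V *m kroG F n) i j = delay (entry V i) j.
Proof.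
move: i j; apply: entry_mulP => [i [|j] //= /orP[mi|nj]|i [[|j] jn] /=].
- by rewrite entry_row0.
- by rewrite entry_col0.
- by rewrite big1 // => k _; rewrite mxE mulr0.
by rewrite -sum_delta_col; apply: eq_bigr => k _; rewrite mxE eqSS eq_sym.
Qed.

Lemma entry_kroF_trl V i j : entry ((kroF F m)^T *m V) i j = entry V i j.
Proof.
move: i j; apply: entry_mulP => [i j /orP[mi|nj]|i j].
- by rewrite entry_row0 // ltnW.
- by rewrite entry_col0.
by rewrite -sum_delta_row; apply: eq_bigr => k _; rewrite !mxE eq_sym.
Qed.

Lemma entry_kroG_trl V i j :
  entry ((kroG F m)^T *m V) i j = delay (entry V ^~ j) i.
Proof.
move: i j; apply: entry_mulP => [[|i] j //= /orP[mi|nj]|[[|i] im] j /=].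
- by rewrite entry_row0.
- by rewrite entry_col0.
- by rewrite big1 // => k _; rewrite !mxE mul0r.
by rewrite -sum_delta_row; apply: eq_bigr => k _; rewrite !mxE eqSS eq_sym.
Qed.

Lemma entry_kroFl (V : 'M[F]_(m.+1, n)) i j : (i < m)%N ->
  entry (kroF F m *m V) i j = entry V i j.
Proof.
move=> im; case: (ltnP j n) => jn; last by rewrite !entry_col0.
rewrite -(entryE _ (Ordinal im) (Ordinal jn)) mxE.
rewrite -(sum_delta_row V i (Ordinal jn)).
by apply: eq_bigr => k _; rewrite !mxE.
Qed.

Lemma entry_kroGl (V : 'M[F]_(m.+1, n)) i j :
  entry (kroG F m *m V) i j = entry V i.+1 j.
Proof.
move: i j; apply: entry_mulP => [i j /orP[mi|nj]|i j].
- by rewrite entry_row0.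
- by rewrite entry_col0.
by rewrite -sum_delta_row; apply: eq_bigr => k _; rewrite !mxE.
Qed.

Lemma entry_mx (f : nat -> nat -> F) i j :
  entry (\matrix_(i < m, j < n) f i j) i j =
  if (i < m)%N && (j < n)%N then f i j else 0.
Proof.
case: (ltnP i m) => im /=; last by rewrite entry_row0.
case: (ltnP j n) => jn; last by rewrite entry_col0.
by rewrite -(entryE _ (Ordinal im) (Ordinal jn)) mxE.
Qed.

End EntryProducts.

Section HomDimensionEntries.
Variable F : fieldType.
Variables (m n p q : nat) (P : mxpair F m n) (Q : mxpair F p q).

(** For solutions that are constant on the level sets of [idx]: the value on level [k < d] is free
    and is read at [(a k, b k)], while levels from [d] on are forced to be zero. *)
Lemma hom_dim_index d (idx : nat -> nat -> nat) (a b : nat -> nat) :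
  (forall k, (k < d)%N -> [/\ (a k < n)%N, (b k < p)%N & idx (a k) (b k) = k]) ->
  (forall (u : nat -> F) V, (forall k, (d <= k)%N -> u k = 0) ->
     (forall i j, entry V i j =
        if (i < n)%N && (j < p)%N then u (idx i j) else 0) ->
     intertwines P Q V) ->
  (forall V, intertwines P Q V -> forall i j, (i < n)%N -> (j < p)%N ->
     let k := idx i j in
     entry V i j = if (k < d)%N then entry V (a k) (b k) else 0) ->
  hom_dim P Q d.
Proof.
move=> hab hu hV; exists (fun u => \matrix_(i, j) entry u 0 (idx i j)); split.
- move=> c u v; apply/matrixP=> i j; rewrite !mxE.
  case: (ltnP (idx i j) d) => kd; last by rewrite !entry_col0 ?mulr0 ?addr0.
  by rewrite -!(entryE _ 0 (Ordinal kd)) !mxE.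
- move=> u u0; apply/rowP=> k; rewrite mxE.
  have [ak bk ek] := hab _ (ltn_ord k).
  have /matrixP/(_ (Ordinal ak) (Ordinal bk)) := u0.
  by rewrite !mxE /= ek -(entryE _ 0).
move=> V; split=> [VP|[u ->]]; last first.
  apply: (hu (entry u 0)) => [k dk|i j]; first by rewrite entry_col0.
  exact: (entry_mx _ _ (fun i j => entry u 0 (idx i j))).
exists (\row_k entry V (a k) (b k)); apply/matrixP=> i j.
rewrite mxE entryE hV //; case: ltnP => kd; last by rewrite entry_col0.
by rewrite -(entryE _ 0 (Ordinal kd)) mxE.
Qed.
End HomDimensionEntries.

Lemma down_ind m (Pr : nat -> Prop) :
  (forall i, (m <= i)%N -> Pr i) -> (forall i, (i < m)%N -> Pr i.+1 -> Pr i) ->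
  forall i, Pr i.
Proof.
move=> h0 h1 i; have [d] := ubnP (m - i)%N; elim: d i => // d IHd i lt.
case: (leqP m i) => mi; first exact: h0.
by apply: h1 => //; apply: IHd; lia.
Qed.

(** * Intertwiners of Kronecker blocks with test pairs *)

Section Tests.
Variable F : fieldType.

(** The first two tests detect the eigenvalue [lam] and the infinite eigenvalue. For [poly_test] the
    columns of [V] are the coefficients of a polynomial solution, of degree below [p], of
    [(P.1 - t P.2) v(t) = 0]. *)
Definition eigen_test p (lam : F) : mxpair F p p := (jordan_block p lam, 1%:M).
Definition infty_test p : mxpair F p p := (1%:M, jordan_block p 0).
Definition poly_test p : mxpair F p p.+1 := (kroF F p, kroG F p).

(** [V] is constant along diagonals and zero below the main one, to which [idx] gives the
    out-of-range level [n + p]. Elsewhere [idx] is the row where the diagonal meets the last column;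
    a diagonal leaving through the last row earlier is zero. *)
Lemma hom_toeplitz m n p q (P : mxpair F m n) (Q : mxpair F p q) :
  (forall V, intertwines P Q V <-> forall i j, (i < n)%N -> (j < p)%N ->
     entry V i.+1 j = delay (entry V i) j) ->
  hom_dim P Q (minn n p).
Proof.
move=> h; pose idx i j := if (i <= j)%N then (p.-1 + i - j)%N else (n + p)%N.
apply: (hom_dim_index (idx := idx) (a := fun=> 0%N) (b := fun k => p.-1 - k)%N).
- by move=> k; rewrite leq_min /idx leq0n => /andP[kn kp]; split; lia.
- move=> u V u0 eV; apply/h => i j ilt jlt; rewrite eV.
  case: j jlt => [|j] jlt /=.
    by case: ifP => // _; rewrite u0 // /idx ltn0; lia.
  rewrite eV ilt (ltnW jlt) jlt andbT /=.
  case: ifP => i1; first by congr u; rewrite /idx; do !case: ifP; lia.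
  by rewrite u0 // /idx; case: ifP; lia.
move=> V /h hV.
have hdiag i j t : (i + t <= n)%N -> (j + t < p)%N ->
    entry V i j = entry V (i + t) (j + t).
  elim: t => [|t IHt] it jt; first by rewrite !addn0.
  rewrite IHt; [|lia..]; rewrite !addnS hV //; lia.
move=> i j ilt jlt; rewrite /idx; case: (leqP i j) => ij.
  case: ifP => [kd|/negbT kd].
    by rewrite [RHS](hdiag _ _ i) ?add0n; [congr entry; lia | lia..].
  rewrite (hdiag i j (n - i)%N); [|lia..].
  by rewrite entry_row0 //; lia.
rewrite ifF; last by lia.
have -> : entry V i j = entry V (i - j) 0.
  by rewrite [RHS](hdiag _ _ j); [congr entry; lia | lia..].
have -> : (i - j = (i - j).-1.+1)%N by lia.
by rewrite hV //; lia.
Qed.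

Lemma intertwines_entry m n p q (P : mxpair F m n) (Q : mxpair F p q) V :
  intertwines P Q V <-> forall i j, (i < m)%N -> (j < q)%N ->
    entry (P.1 *m V *m Q.1) i j = entry (P.2 *m V *m Q.2) i j.
Proof. by split=> [-> //|/entryP]. Qed.

Lemma hom_eigen_KroJ n p lam :
  hom_dim (kro_pair (KroJ n lam)) (eigen_test p lam) (minn n.+1 p).
Proof.
apply: hom_toeplitz => V; rewrite intertwines_entry /= mul1mx mulmx1.
split=> h i j ilt jlt; have := h i j ilt jlt;
  rewrite entry_jordanl entry_jordanr //; first by move/addrI.
by move=> ->.
Qed.

Lemma hom_infty_KroJinf n p :
  hom_dim (kro_pair (KroJinf n)) (infty_test p) (minn n.+1 p).
Proof.
apply: hom_toeplitz => V; rewrite intertwines_entry /= mul1mx mulmx1.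
split=> h i j ilt jlt; have := h i j ilt jlt;
  by rewrite entry_jordanl entry_jordanr // !mul0r !add0r.
Qed.

(** Sylvester's equation with distinct eigenvalues: [(lam - mu) V i j] is determined by the entries
    below and to the left. *)
Lemma hom_eigen_KroJ0 n p lam mu : mu != lam ->
  hom_dim (kro_pair (KroJ n mu)) (eigen_test p lam) 0.
Proof.
move=> ne; apply: hom_dim0 => V /intertwines_entry /= h.
suff h' j : (j < p)%N -> forall i, entry V i j = 0.
  by apply: entryP => i j _ jp; rewrite h' // entry0.
elim: j => [|j IHj] jp;
  (apply: (down_ind (m := n.+1)); first by move=> i ilt; rewrite entry_row0);
  move=> i ilt IHi; have := h i _ ilt jp;
  rewrite mul1mx mulmx1 entry_jordanl entry_jordanr // IHi addr0 /= ?IHj ?addr0;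
  try lia.
all: move/eqP; rewrite -subr_eq0 -mulrBl mulf_eq0 subr_eq0 eq_sym (negPf ne).
all: by move=> /eqP.
Qed.

(** The equation [V = J V J'] with [J] nilpotent expresses each row of [V] through the next one. *)
Lemma hom_eigen_KroJinf n p lam :
  hom_dim (kro_pair (KroJinf n)) (eigen_test p lam) 0.
Proof.
apply: hom_dim0 => V /intertwines_entry /= h.
suff h' i : forall j, (j < p)%N -> entry V i j = 0.
  by apply: entryP => i j _ jp; rewrite h' // entry0.
move: i; apply: (down_ind (m := n.+1)) => i ilt.
  by move=> *; apply: entry_row0.
move=> IHi j jp; have := h i _ ilt jp.
rewrite mul1mx mulmx1 entry_jordanr // !entry_jordanl mul0r add0r IHi //.
rewrite mulr0 add0r.
by case: j jp => [|j] jp /= <- //; rewrite entry_jordanl mul0r add0r IHi //; lia.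
Qed.

Lemma hom_eigen_KroFGT n p lam :
  hom_dim (kro_pair (KroFGT n)) (eigen_test p lam) 0.
Proof.
apply: hom_dim0 => V /intertwines_entry /= h.
suff h' i : forall j, (j < p)%N -> entry V i j = 0.
  by apply: entryP => i j _ jp; rewrite h' // entry0.
move: i; apply: (down_ind (m := n)) => i ilt; first by move=> *; apply: entry_row0.
move=> IHi j jp; have := h i.+1 j ilt jp.
rewrite mulmx1 entry_jordanr // entry_kroF_trl entry_kroG_trl /= IHi //.
rewrite mulr0 add0r => <-.
by case: j jp => [|j] jp //=; rewrite entry_kroF_trl IHi //; lia.
Qed.

(** Each row of [V] is the previous one times [J], so row 0 is arbitrary and determines the
    others. *)
Lemma hom_eigen_KroFG n p lam :
  hom_dim (kro_pair (KroFG n)) (eigen_test p lam) p.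
Proof.
pose J := jordan_block p lam.
pose f i (u : 'rV[F]_p) := iter i (fun u => u *m J) u.
exists (fun u => \matrix_(i, j) f i u 0 j); split.
- move=> a u v; apply/matrixP=> i j; rewrite !mxE.
  rewrite (_ : f i _ = a *: f i u + f i v) ?mxE //.
  by elim: {j}(i : nat) => //= k ->; rewrite mulmxDl scalemxAl.
- by move=> u u0; apply/rowP=> j; have /matrixP/(_ 0 j) := u0; rewrite !mxE.
have rowE V : intertwines (kro_pair (KroFG n)) (eigen_test p lam) V <->
    forall i, (i < n)%N -> forall j, (j < p)%N ->
    entry V i.+1 j = lam * entry V i j + delay (entry V i) j.
  rewrite intertwines_entry /= mulmx1; split=> h i.
    move=> ilt j jlt; have := h i j ilt jlt.
    rewrite entry_kroGl entry_jordanr // entry_kroFl // => <-; congr (_ + _).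
    by case: j {jlt} => //= j; rewrite entry_kroFl.
  move=> j ilt jlt; rewrite entry_kroGl entry_jordanr // entry_kroFl // h //.
  congr (_ + _); by case: j {jlt} => //= j; rewrite entry_kroFl.
have fS i (u : 'rV_p) j : (j < p)%N ->
    entry (f i.+1 u) 0 j = lam * entry (f i u) 0 j + delay (entry (f i u) 0) j.
  by move=> jp; rewrite /= entry_jordanr.
have entryf u i j : (i < n.+1)%N ->
    entry (\matrix_(i < n.+1, j < p) f i u 0 j) i j = entry (f i u) 0 j.
  move=> ilt; case: (ltnP j p) => jp; last by rewrite !entry_col0.
  by rewrite -(entryE _ (Ordinal ilt) (Ordinal jp)) -(entryE _ 0 (Ordinal jp)) mxE.
move=> V; rewrite rowE; split=> [h|[u ->] i ilt j jlt]; last first.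
  have ilt' := leqW ilt; rewrite !entryf // fS //; congr (_ + _).
  by case: j {jlt} => //= j; rewrite entryf // ltnW.
pose u : 'rV_p := row (ord0 : 'I_n.+1) V.
exists u; apply/entryP => i j.
have row0 k : entry u 0 k = entry V 0 k.
  case: (ltnP k p) => kp; last by rewrite !entry_col0.
  by rewrite -(entryE _ 0 (Ordinal kp)) mxE (entryE _ ord0 (Ordinal kp)).
elim: i j => [|i IHi] j ilt jlt; rewrite entryf //.
have ilt' := ltnW ilt; rewrite fS // h // IHi // entryf //; congr (_ + _).
by case: j jlt => //= j jlt; rewrite IHi ?entryf // ltnW.
Qed.

Lemma hom_infty_KroJ n p mu :
  hom_dim (kro_pair (KroJ n mu)) (infty_test p) 0.
Proof.
apply: hom_dim0 => V /intertwines_entry /= h.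
suff h' j : (j < p)%N -> forall i, entry V i j = 0.
  by apply: entryP => i j _ jp; rewrite h' // entry0.
elim: j => [|j IHj] jp i; case: (ltnP i n.+1) => ilt; try exact: entry_row0.
all: have := h i _ ilt jp; rewrite mulmx1 mul1mx entry_jordanr //.
all: rewrite mul0r add0r => -> //=.
by rewrite entry_jordanl !IHj ?mulr0 ?addr0 // ltnW.
Qed.

Lemma hom_infty_KroFGT n p :
  hom_dim (kro_pair (KroFGT n)) (infty_test p) 0.
Proof.
apply: hom_dim0 => V /intertwines_entry /= h.
suff h' i : forall j, (j < p)%N -> entry V i j = 0.
  by apply: entryP => i j _ jp; rewrite h' // entry0.
elim: i => [|i IHi] j jp.
  have := h 0%N j isT jp; rewrite mulmx1 entry_jordanr // entry_kroF_trl => ->.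
  rewrite entry_kroG_trl mulr0 add0r.
  by case: j {jp} => //= j; rewrite entry_kroG_trl.
case: (ltnP i.+1 n.+1) => ilt; last by rewrite entry_row0 // ltnW.
have := h _ j ilt jp; rewrite mulmx1 entry_jordanr // entry_kroF_trl => ->.
rewrite mul0r add0r; case: j jp => //= j jp; rewrite entry_kroG_trl /= IHi //.
exact: ltnW.
Qed.

(** [V] is constant along antidiagonals and determined by its free last row. [idx] is the column
    where an antidiagonal meets that row, or [p] if it leaves through column 0 first and is
    therefore zero. *)
Lemma hom_infty_KroFG n p :
  hom_dim (kro_pair (KroFG n)) (infty_test p) p.
Proof.
pose idx i j := if (n <= i + j)%N then (i + j - n)%N else p.
have rowE V : intertwines (kro_pair (KroFG n)) (infty_test p) V <->
    forall i j, (i < n)%N -> (j < p)%N ->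
    entry V i j = delay (entry V i.+1) j.
  rewrite intertwines_entry /= mulmx1; split=> h i j ilt jlt.
    have := h i j ilt jlt.
    rewrite entry_kroFl // entry_jordanr // mul0r add0r => ->.
    by case: j {jlt} => //= j; rewrite entry_kroGl.
  rewrite entry_kroFl // entry_jordanr // mul0r add0r h //.
  by case: j {jlt} => //= j; rewrite entry_kroGl.
apply: (hom_dim_index (idx := idx) (a := fun=> n) (b := id)).
- by move=> k kp; rewrite /idx leq_addr /= addKn.
- move=> u V u0 eV; apply/rowE => i j ilt jlt; rewrite eV.
  rewrite [_ && _]andbC jlt /= ltnW //; case: j jlt => [|j] jlt /=.
    by rewrite u0 // /idx addn0 (leqNgt n i) ilt.
  by rewrite eV /= !ltnS ilt (ltnW jlt) /= /idx addSnnS.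
move=> V /rowE hV i j; move: i j; apply: (down_ind (m := n)) => i ilt.
  move=> j iltn jlt; have -> : i = n by move: iltn; rewrite /=; lia.
  by rewrite /idx leq_addr addKn jlt.
move=> IHi j _ jlt; rewrite hV //; case: j jlt => [|j] jlt /=.
  by rewrite /idx addn0 (leqNgt n i) ilt /= ltnn.
by rewrite IHi // ?(ltnW jlt) // /idx addSnnS.
Qed.

Lemma hom_poly_KroJ n p mu :
  hom_dim (kro_pair (KroJ n mu)) (poly_test p) 0.
Proof.
apply: hom_dim0 => V /intertwines_entry /= h.
suff h' j : (j < p)%N -> forall i, entry V i j = 0.
  by apply: entryP => i j _ jp; rewrite h' // entry0.
elim: j => [|j IHj] jp i; case: (ltnP i n.+1) => ilt; try exact: entry_row0.
all: have := h i _ ilt (leqW jp); rewrite mul1mx entry_kroFr entry_kroGr => -> //=.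
by rewrite entry_jordanl !IHj ?mulr0 ?addr0 // ltnW.
Qed.

Lemma hom_poly_KroJinf n p :
  hom_dim (kro_pair (KroJinf n)) (poly_test p) 0.
Proof.
apply: hom_dim0 => V /intertwines_entry /= h.
suff h' i : forall j, (j < p)%N -> entry V i j = 0.
  by apply: entryP => i j _ jp; rewrite h' // entry0.
move: i; apply: (down_ind (m := n.+1)) => i ilt.
  by move=> *; apply: entry_row0.
move=> IHi j jp; have := h i j.+1 ilt jp.
rewrite entry_kroFr entry_kroGr /= mul1mx entry_jordanl mul0r add0r => <-.
case: (ltnP j.+1 p) => jp1; first exact: IHi.
exact: entry_col0.
Qed.

Lemma hom_poly_KroFGT n p :
  hom_dim (kro_pair (KroFGT n)) (poly_test p) 0.
Proof.
apply: hom_dim0 => V /intertwines_entry /= h.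
suff h' i : forall j, (j < p)%N -> entry V i j = 0.
  by apply: entryP => i j _ jp; rewrite h' // entry0.
elim: i => [|i IHi] j jp.
  have := h 0%N j isT (leqW jp).
  rewrite entry_kroFr entry_kroGr entry_kroF_trl => ->.
  by case: j {jp} => //= j; rewrite entry_kroG_trl.
case: (ltnP i.+1 n.+1) => ilt; last by rewrite entry_row0 // ltnW.
have := h _ j ilt (leqW jp).
rewrite entry_kroFr entry_kroGr entry_kroF_trl => ->.
case: j jp => //= j jp; rewrite entry_kroG_trl /= IHi //.
exact: ltnW.
Qed.

(** As for [infty_test], but the additional column of the test also kills the antidiagonals with
    [p <= i + j]; those with [n <= i + j < p] remain. *)
Lemma hom_poly_KroFG n p :
  hom_dim (kro_pair (KroFG n)) (poly_test p) (p - n).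
Proof.
pose idx i j := if (n <= i + j)%N then (i + j - n)%N else p.
have rowE V : intertwines (kro_pair (KroFG n)) (poly_test p) V <->
    forall i j, (i < n)%N -> (j < p.+1)%N ->
    entry V i j = delay (entry V i.+1) j.
  rewrite intertwines_entry /=; split=> h i j ilt jlt.
    have := h i j ilt jlt; rewrite entry_kroFr entry_kroGr entry_kroFl // => ->.
    by case: j {jlt} => //= j; rewrite entry_kroGl.
  rewrite entry_kroFr entry_kroGr entry_kroFl // h //.
  by case: j {jlt} => //= j; rewrite entry_kroGl.
apply: (hom_dim_index (idx := idx) (a := fun=> n) (b := id)).
- by move=> k kp; rewrite /idx leq_addr /= addKn ltnS; split=> //; lia.
- move=> u V u0 eV; apply/rowE => i j ilt jlt; rewrite eV.
  rewrite /= (leqW ilt) /=; case: j jlt => [|j] jlt /=.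
    by case: ifP => // _; rewrite u0 // /idx addn0 (leqNgt n i) ilt leq_subr.
  rewrite eV /= !ltnS ilt /=; rewrite ltnS in jlt; rewrite jlt /idx addSnnS.
  by case: ifP => // jp; rewrite u0 //; case: ifP; lia.
move=> V /rowE hV.
have hup i j : (i <= n)%N -> (p <= i + j)%N -> entry V i j = 0.
  elim: i j => [|i IHi] j ilt ij; first by rewrite entry_col0.
  case: (ltnP j p) => jp; last by rewrite entry_col0.
  have := hV i j.+1 ilt jp; rewrite /= => <-; apply: IHi; lia.
have hdown i j : (i < n.+1)%N -> (j < p)%N ->
    entry V i j = if (n <= i + j)%N then entry V n (i + j - n) else 0.
  move: i j; apply: (down_ind (m := n)) => i ilt.
    move=> j iltn jlt; have -> : i = n by lia.
    by rewrite leq_addr addKn.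
  move=> IHi j _ jlt; rewrite hV ?leqW //; case: j jlt => [|j] jlt /=.
    by rewrite addn0 (leqNgt n i) ilt.
  by rewrite IHi // ?(ltnW jlt) // addSnnS.
move=> i j ilt jlt /=; rewrite /idx hdown //.
case: ifP => nij; last by rewrite ifF //; lia.
case: ifP => // nd; apply: hup => //; lia.
Qed.
End Tests.

(** * Multiplicities from dimensions of intertwiners *)

Section KroneckerUniqueness.
Variable F : fieldType.
Notation kro_dsum := (dsum (@kro_pair F)).
Implicit Types (c : seq (kro_summand F)) (x : kro_summand F).

Definition eigen_hom_dim lam p x : nat :=
  match x with
  | KroJ n mu => if mu == lam then minn n.+1 p else 0
  | KroFG n => p
  | _ => 0
  end.

Definition infty_hom_dim p x : nat :=
  match x with
  | KroJinf n => minn n.+1 p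
  | KroFG n => p
  | _ => 0
  end.

Definition poly_hom_dim p x : nat := if x is KroFG n then p - n else 0.

Lemma hom_dim_eigen lam p x :
  hom_dim (kro_pair x) (eigen_test p lam) (eigen_hom_dim lam p x).
Proof.
case: x => [n mu|n|n|n] /=.
- case: eqVneq => [->|ne]; first exact: hom_eigen_KroJ.
  exact: hom_eigen_KroJ0.
- exact: hom_eigen_KroJinf.
- exact: hom_eigen_KroFG.
- exact: hom_eigen_KroFGT.
Qed.

Lemma hom_dim_infty p x :
  hom_dim (kro_pair x) (infty_test F p) (infty_hom_dim p x).
Proof.
case: x => [n mu|n|n|n] /=.
- exact: hom_infty_KroJ.
- exact: hom_infty_KroJinf.
- exact: hom_infty_KroFG.
- exact: hom_infty_KroFGT.
Qed.

Lemma hom_dim_poly p x :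
  hom_dim (kro_pair x) (poly_test F p) (poly_hom_dim p x).
Proof.
case: x => [n mu|n|n|n] /=.
- exact: hom_poly_KroJ.
- exact: hom_poly_KroJinf.
- exact: hom_poly_KroFG.
- exact: hom_poly_KroFGT.
Qed.

Lemma sum_hom_dim_eqv p q (Q : mxpair F p q) d c c' :
  (forall x, hom_dim (kro_pair x) Q (d x)) -> eqv (kro_dsum c) (kro_dsum c') ->
  sumn (map d c) = sumn (map d c').
Proof.
move=> hd cc'; have h := hom_dim_dsum _ hd.
exact: (hom_dim_uniq (hom_dim_eqv cc' (h c)) (h c')).
Qed.

(* Each multiplicity is a second difference, in the size [p] of the test pair,
   of the dimensions of the spaces of intertwiners. *)
Lemma count_second_difference x0 (d : nat -> kro_summand F -> nat) p c :
  (forall x, (x == x0) + d p.-1 x + d p.+1 x = (d p x).*2)%N ->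
  (count_mem x0 c + sumn (map (d p.-1) c) + sumn (map (d p.+1) c) =
   (sumn (map (d p) c)).*2)%N.
Proof. by move=> hd; elim: c => //= x c IHc; have := hd x; lia. Qed.

(** As a function of [p], [minn k.+1 p] has its only kink at [p = k.+1], and the contribution [p] of
    [KroFG] is linear. *)
Lemma count_KroJ n lam c c' : eqv (kro_dsum c) (kro_dsum c') ->
  count_mem (KroJ n lam) c = count_mem (KroJ n lam) c'.
Proof.
move=> cc'; have h p := sum_hom_dim_eqv (hom_dim_eigen lam p) cc'.
have hd x : ((x == KroJ n lam) + eigen_hom_dim lam n.+1.-1 x +
    eigen_hom_dim lam n.+2 x = (eigen_hom_dim lam n.+1 x).*2)%N.
  case: eqP => [->|]; first by rewrite /= eqxx; lia.
  case: x => [k mu|k|k|k] /=; try lia; case: eqP => [->|] ne; last by lia.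
  have kn : k <> n by move=> kn; case: ne; rewrite kn.
  lia.
have := count_second_difference c hd; have := count_second_difference c' hd.
by rewrite !h; lia.
Qed.

Lemma count_KroJinf n c c' : eqv (kro_dsum c) (kro_dsum c') ->
  count_mem (KroJinf n) c = count_mem (KroJinf n) c'.
Proof.
move=> cc'; have h p := sum_hom_dim_eqv (hom_dim_infty p) cc'.
have hd x : ((x == KroJinf n) + infty_hom_dim n.+1.-1 x +
    infty_hom_dim n.+2 x = (infty_hom_dim n.+1 x).*2)%N.
  case: eqP => [->|]; first by rewrite /=; lia.
  case: x => [k mu|k|k|k] /= ne; try lia.
  have kn : k <> n by move=> kn; case: ne; rewrite kn.
  lia.
have := count_second_difference c hd; have := count_second_difference c' hd.
by rewrite !h; lia.
Qed.

(** Truncated subtraction [p - k] is convex in [p], so the second difference has the opposite sign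
    to [count_second_difference]. For [n = 0] the predecessor stays 0, where all these dimensions
    vanish. *)
Lemma count_KroFG n c c' : eqv (kro_dsum c) (kro_dsum c') ->
  count_mem (KroFG n) c = count_mem (KroFG n) c'.
Proof.
move=> cc'; have h p := sum_hom_dim_eqv (hom_dim_poly p) cc'.
have hd x : ((x == KroFG n) + (poly_hom_dim n x).*2 =
    poly_hom_dim n.-1 x + poly_hom_dim n.+1 x)%N.
  case: eqP => [->|]; first by rewrite /=; lia.
  case: x => [k mu|k|k|k] /= ne; try lia.
  have kn : k <> n by move=> kn; case: ne; rewrite kn.
  lia.
have hsum u : (count_mem (KroFG n) u + (sumn (map (poly_hom_dim n) u)).*2 =
    sumn (map (poly_hom_dim n.-1) u) + sumn (map (poly_hom_dim n.+1) u))%N.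
  by elim: u => //= x u IHu; have /= := hd x; lia.
by have := hsum c; have := hsum c'; rewrite !h; lia.
Qed.

Lemma count_tr_kro n c :
  count_mem (KroFG n) (map (@tr_kro F) c) = count_mem (KroFGT n) c.
Proof. by rewrite count_map; apply: eq_count => -[]. Qed.

(** All three tests give 0 on [KroFGT]; transposition turns these blocks into [KroFG]. *)
Lemma count_KroFGT n c c' : eqv (kro_dsum c) (kro_dsum c') ->
  count_mem (KroFGT n) c = count_mem (KroFGT n) c'.
Proof.
move=> cc'; rewrite -!count_tr_kro; apply: count_KroFG.
exact: eqv_trans (eqv_sym (dsum_tr_kro (eqv_refl _))) (dsum_tr_kro cc').
Qed.

Lemma kronecker_unique c c' : eqv (kro_dsum c) (kro_dsum c') -> perm_eq c c'.
Proof.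
move=> cc'; apply/allP => -[n lam|n|n|n] _ /=; apply/eqP.
- exact: count_KroJ.
- exact: count_KroJinf.
- exact: count_KroFG.
- exact: count_KroFGT.
Qed.

Lemma symmetric_count n (A B : 'M[F]_n) c k :
  A \is symmetricmx -> B \is symmetricmx -> eqv (A, B) (kro_dsum c) ->
  count_mem (KroFG k) c = count_mem (KroFGT k) c.
Proof.
rewrite !symmetricmxE => /eqP sA /eqP sB ABc; rewrite -count_tr_kro.
apply: count_KroFG; apply: eqv_trans (eqv_sym ABc) _.
by have := dsum_tr_kro ABc; rewrite /tr_pair /= sA sB.
Qed.
End KroneckerUniqueness.

(** * Symmetric summands versus Kronecker summands *)

Definition sym_kcf (F : Type) (x : sym_summand F) : seq (kro_summand F) :=
  match x with
  | SymJ n lam => [:: KroJ n lam]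
  | SymJinf n => [:: KroJinf n]
  | SymPath k => [:: KroFG k; KroFGT k]
  end.

(** [KroFGT n] yields nothing, since [SymPath n] is already produced by its partner [KroFG n]. *)
Definition kro_sym (F : Type) (x : kro_summand F) : option (sym_summand F) :=
  match x with
  | KroJ n lam => Some (SymJ n lam)
  | KroJinf n => Some (SymJinf n)
  | KroFG n => Some (SymPath n)
  | KroFGT n => None
  end.

(** Each symmetric summand owns a block [kro_of y] that no other summand contributes, so
    multiplicities can be read back. *)
Lemma sym_kcf_perm (F : eqType) (s t : seq (sym_summand F)) :
  perm_eq (flatten (map (@sym_kcf F) s)) (flatten (map (@sym_kcf F) t)) ->
  perm_eq s t.
Proof.
pose kro_of (y : sym_summand F) : kro_summand F :=
  match y with
  | SymJ n lam => KroJ n lam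
  | SymJinf n => KroJinf n
  | SymPath k => KroFG k
  end.
have count_kcf u y :
    count_mem (kro_of y) (flatten (map (@sym_kcf F) u)) = count_mem y u.
  elim: u => //= x u IHu; rewrite count_cat IHu; congr (_ + _)%N.
  by case: x y {IHu} => [? ?|?|?] [? ?|?|?]; rewrite /= ?addn0.
move=> /permP st; apply/allP => y _ /=.
by rewrite -!count_kcf st.
Qed.

Lemma balanced_kcf (F : eqType) (c : seq (kro_summand F)) :
  (forall k, count_mem (KroFG k) c = count_mem (KroFGT k) c) ->
  perm_eq c (flatten (map (@sym_kcf F) (pmap (@kro_sym F) c))).
Proof.
move=> hc; apply/allP => y _ /=; apply/eqP.
(* Balance is used only to count [KroFG n] in place of [KroFGT n]; the rest is an induction on
   [c]. *)
transitivity (count_mem (if y is KroFGT n then KroFG n else y) c).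
  by case: y => //= n; rewrite hc.
elim: c {hc} => //= -[n lam|n|n|n] c /= <-.
all: by case: y => [n' lam'|n'|n'|n'].
Qed.

(** * Symmetric summands *)

Section SymmetricSummands.
Variables (F : fieldType) (N : forall n : nat, 'M[F]_n).
Hypothesis hN : forall n : nat, (0 < n)%N ->
  [/\ tridiagonal (N n), N n \is symmetricmx
    & similar_in unitmx (N n) (jordan_block n (0 : F))].

Lemma tridiagonal_scalar n (lam : F) : tridiagonal (lam%:M : 'M_n).
Proof.
move=> i j ij; rewrite mxE -val_eqE /=.
by have -> : (i == j :> nat) = false by lia.
Qed.

Lemma tridiagonalD n (A B : 'M[F]_n) :
  tridiagonal A -> tridiagonal B -> tridiagonal (A + B).
Proof. by move=> tA tB i j ij; rewrite mxE tA // tB // addr0. Qed.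

Lemma sym_pair_tridiagonal x :
  tridiagonal (sym_pair N x).1 /\ tridiagonal (sym_pair N x).2.
Proof.
case: x => [n lam|n|k] /=.
- have [tN _ _] := hN (ltn0Sn n).
  by split; [exact: tridiagonal_scalar | exact/tridiagonalD/tN/tridiagonal_scalar].
- have [tN _ _] := hN (ltn0Sn n).
  by split; [exact: tN | exact: tridiagonal_scalar].
split=> i j ij; rewrite mxE.
all: have -> : (j == i.+1 :> nat) = false by lia.
all: by have -> : (i == j.+1 :> nat) = false by lia.
Qed.

Lemma sym_pair_tr x : tr_pair (sym_pair N x) = sym_pair N x.
Proof.
case: x => [n lam|n|k]; rewrite /tr_pair /=.
- have [_ + _] := hN (ltn0Sn n); rewrite symmetricmxE => /eqP sN.
  by rewrite linearD /= !tr_scalar_mx sN.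
- have [_ + _] := hN (ltn0Sn n); rewrite symmetricmxE => /eqP sN.
  by rewrite tr_scalar_mx sN.
by congr pair; apply/matrixP=> i j; rewrite !mxE orbC.
Qed.

Lemma dsum_sym_pair_symmetric s :
  (dsum (sym_pair N) s).1 \is symmetricmx /\
  (dsum (sym_pair N) s).2 \is symmetricmx.
Proof.
rewrite !symmetricmxE; elim: s => [|x s [/eqP IH1 /eqP IH2]] /=.
  by rewrite trmx0 !eqxx.
have /= e1 := congr1 fst (sym_pair_tr x); have /= e2 := congr1 snd (sym_pair_tr x).
by rewrite !tr_block_mx !trmx0 IH1 IH2 e1 e2 !eqxx.
Qed.

(** The similarity of [N] to the Jordan block, applied to both components, fixes the identity
    matrix. *)
Lemma sym_pair_kcf x : eqv (sym_pair N x) (dsum (@kro_pair F) (sym_kcf x)).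
Proof.
have similarN n : exists2 P : 'M[F]_n.+1, P \in unitmx &
    P *m N n.+1 *m invmx P = jordan_block n.+1 0.
  have [_ _ [P uP /eqP e]] := hN (ltn0Sn n); exists P => //.
  by rewrite -e conjumx.
case: x => [n lam|n|k] /=; last exact: path_pair_kro.
- apply: eqv_trans _ (eqv_sym (dsum1 (@kro_pair F) (KroJ n lam))).
  have [P uP e] := similarN n.
  have iP := inverse_mx_unit uP.
  exists P, (invmx P), (invmx P), P; split=> //.
  + exact: inverse_mx_sym.
  + by rewrite mulmx1 mulmxV.
  rewrite /= mulmxDr mulmxDl e scalar_mxC -mulmxA mulmxV // mulmx1.
  by rewrite addrC -jordan_blockD add0r.
- apply: eqv_trans _ (eqv_sym (dsum1 (@kro_pair F) (KroJinf n))).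
  have [P uP e] := similarN n.
  have iP := inverse_mx_unit uP.
  exists P, (invmx P), (invmx P), P; split=> //.
  + exact: inverse_mx_sym.
  + by rewrite mulmx1 mulmxV.
Qed.

Lemma dsum_sym_pair_kcf s :
  eqv (dsum (sym_pair N) s)
      (dsum (@kro_pair F) (flatten (map (@sym_kcf F) s))).
Proof. exact/dsum_flatten/sym_pair_kcf. Qed.

Lemma dsum_sym_pair_unique s t :
  eqv (dsum (sym_pair N) s) (dsum (sym_pair N) t) -> perm_eq s t.
Proof.
move=> st; apply/sym_kcf_perm/kronecker_unique.
apply: eqv_trans (eqv_sym (dsum_sym_pair_kcf s)) _.
exact: eqv_trans st (dsum_sym_pair_kcf t).
Qed.

Lemma congruent_eqv m n (P : mxpair F m m) (Q : mxpair F n n) :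
  congruent P Q -> eqv P Q.
Proof.
move=> [e [S [uS e1 e2]]]; apply/equivalentP.
by exists e, e, S^T, S; rewrite unitmx_tr.
Qed.
End SymmetricSummands.

Theorem theorem3p2 (F : closedFieldType) (charF : (2 \notin [pchar F])%N)
    (N : forall n : nat, 'M[F]_n)
    (hN : forall n : nat, (0 < n)%N ->
       [/\ tridiagonal (N n), N n \is symmetricmx
         & similar_in unitmx (N n) (jordan_block n (0 : F))]) :
  ((* (a) *)
   (forall x : sym_summand F,
      tridiagonal (sym_pair N x).1 /\ tridiagonal (sym_pair N x).2) /\
   (forall (n : nat) (A B : 'M[F]_n),
      A \is symmetricmx -> B \is symmetricmx ->
      exists2 s : seq (sym_summand F),
        congruent (A, B) (dsum (sym_pair N) s)
        & forall t : seq (sym_summand F),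
            congruent (A, B) (dsum (sym_pair N) t) -> perm_eq t s))
  /\
  ((* (b) *)
   (forall (n n' : nat) (A B : 'M[F]_n) (A' B' : 'M[F]_n')
      (c c' : seq (kro_summand F)) (s s' : seq (sym_summand F)),
      A \is symmetricmx -> B \is symmetricmx ->
      A' \is symmetricmx -> B' \is symmetricmx ->
      is_KCF (A, B) c -> is_KCF (A', B') c' -> perm_eq c c' ->
      congruent (A, B) (dsum (sym_pair N) s) ->
      congruent (A', B') (dsum (sym_pair N) s') ->
      perm_eq s s') /\
   [/\ forall (n : nat) (lam : F),
         is_KCF (sym_pair N (SymJ n lam)) [:: KroJ n lam],
       forall n : nat,
         is_KCF (sym_pair N (SymJinf n)) [:: KroJinf n]
     & forall k : nat,
         is_KCF (sym_pair N (SymPath k)) [:: KroFG k; KroFGT k]]).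
Proof.
split; split.
- exact: sym_pair_tridiagonal hN.
- move=> n A B sA sB.
  have [c ABc] := kronecker_form ((A, B) : mxpair F n n).
  pose s := pmap (@kro_sym F) c.
  have ABs : eqv (A, B) (dsum (sym_pair N) s).
    (* Symmetry balances the blocks [(F_k, G_k)] with their transposes, so [s] has the Kronecker
       form of [(A, B)]. *)
    have cs := balanced_kcf (fun k => symmetric_count k sA sB ABc).
    apply: eqv_trans ABc (eqv_trans (dsum_perm _ cs) _).
    exact/eqv_sym/dsum_sym_pair_kcf.
  exists s => [|t ABt].
    have [] := dsum_sym_pair_symmetric hN s.
    by case: (dsum _ s) ABs => A' B' ABs sA' sB'; apply: eqv_congruent.
  apply: (dsum_sym_pair_unique hN).
  exact: eqv_trans (eqv_sym (congruent_eqv ABt)) ABs.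
- move=> n n' A B A' B' c c' s s' _ _ _ _ /equivalentP ABc /equivalentP ABc' cc'.
  move=> /congruent_eqv ABs /congruent_eqv ABs'.
  apply: (dsum_sym_pair_unique hN); apply: eqv_trans (eqv_sym ABs) _.
  apply: eqv_trans ABc _; apply: eqv_trans (dsum_perm _ cc') _.
  exact: eqv_trans (eqv_sym ABc') ABs'.
by split=> *; apply/equivalentP/(sym_pair_kcf hN).
Qed.
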